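(* For all integers $n\ge 0$ and all $B \in \{28, 94, 182, 204, 226\}$, $b_{11}(242n+B) \equiv 0 \pmod 2$.
   Context: $b_{11}(n)$ denotes the number of partitions of $n$ none of whose parts is divisible by $11$; equivalently $\sum_{n\ge0} b_{11}(n)q^n = \prod_{i\ge1}(1-q^{11i})/(1-q^i)$. *)

(* Defs.v *)
From mathcomp Require Import all_boot.

Set Implicit Arguments.
Unset Strict Implicit.
Unset Printing Implicit Defensive.

Definition is_partition (n : nat) (s : seq nat) : bool :=
  [&& sorted geq s, all (fun i => 0 < i) s & sumn s == n].

(* A partition of n
   has at most n parts, each at most n, so ranging over sequences of length at
   most n with entries in {0, ..., n} loses none; see [regular_partitionP]. *)
Definition nb_regular_partitions (l n : nat) : nat :=
  #|[set s : n.-bseq 'I_n.+1 |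
       is_partition n (map val s) && all (fun i => ~~ (l %| i)) (map val s)]|.

Lemma regular_partitionP (l n : nat) (p : seq nat) :
  reflect (exists2 s : n.-bseq 'I_n.+1,
             s \in [set s : n.-bseq 'I_n.+1 |
                      is_partition n (map val s) &&
                      all (fun i => ~~ (l %| i)) (map val s)]
             & p = map val s)
          (is_partition n p && all (fun i => ~~ (l %| i)) p).
Proof.
apply: (iffP idP) => [Hp|[s]]; last by rewrite inE => Hs ->.
have /andP[/and3P[_ p_gt0 /eqP sum_p] _] := Hp.
have size_p : size p <= n.
  rewrite -sum_p; elim: p p_gt0 {Hp sum_p} => //= x p IHp /andP[x_gt0 /IHp le_p].
  by rewrite -add1n leq_add.
have le_p i : i \in p -> i <= n.
  rewrite -sum_p; elim: p {Hp p_gt0 sum_p size_p} => //= x p IHp.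
  by rewrite inE => /predU1P[->|/IHp/leq_trans->]; rewrite ?leq_addr ?leq_addl.
have Ep : map val (map (@inord n) p) = p.
  by rewrite -map_comp map_id_in // => i /le_p le_i; rewrite /= inordK.
have size_s : size (map (@inord n) p) <= n by rewrite size_map.
by exists (Bseq size_s); rewrite ?inE /= ?Ep.
Qed.

(* Main.v *)
(* Everything is modulo 2. Let x = prod (1 - q^i), y = x(q^11), and let w be the generating series
   of b_11, so that w x = y. By Shanks' finite identities x = sum q^n over the n with 24n + 1 a square
   and x^3 = sum q^n over the n with 8n + 1 a square. Counting elements of norm M and 3M in
   Z[(1 + sqrt(-11))/2] turns these theta series into the modular equation
     x y = x^12 + q^5 y^12 + q x^3 y^3,
   whence q^5 w y^11 = y + x^11 + q x^2 y^3. Let U keep the exponents divisible by 11 and divide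
   them by 11. Then U(q x^2) = q y^2, and U(x^11) = x + q^5 y^11 because the products of 8u^2 + 3a^2
   with 11 are represented by x^2 + 96z^2. So x^10 y U(q^5 w) = y + x^11, i.e.
     U(q^5 w) = x^(-10) + x/y.
   As x^(-10) is a series in q^2, b_11(22k + 6) is the coefficient of q^(2k+1) in x/y; since y is a
   series in q^11, it vanishes unless 24(2k + 1) + 1 is a square modulo 11. *)

From HB Require Import structures.
Require Import Defs.
From mathcomp Require Import all_boot all_order all_algebra.
From mathcomp Require Import boolp.
From mathcomp Require Import zify ring.

Set Implicit Arguments.
Unset Strict Implicit.
Unset Printing Implicit Defensive.

Import Order.TTheory GRing.Theory Num.Theory.
Local Open Scope ring_scope.

(** * Formal power series *)

(** A type name of its own, so that the ring structure put on it is the one with the convolution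
    product. *)
Definition series (R : Type) := nat -> R.

HB.instance Definition _ (R : Type) := gen_eqMixin (series R).
HB.instance Definition _ (R : Type) := gen_choiceMixin (series R).

Section SeriesRing.

Variable R : comNzRingType.
Implicit Types (f g h : series R) (n N : nat) (p : {poly R}).

Definition series_zero : series R := fun=> 0.
Definition series_one : series R := fun n => (n == 0%N)%:R.
Definition series_opp f : series R := fun n => - f n.
Definition series_add f g : series R := fun n => f n + g n.
Definition series_mul f g : series R := fun n => \sum_(i < n.+1) f i * g (n - i)%N.

Definition trunc N f : {poly R} := \poly_(i < N) f i.

Lemma coef_trunc N f n : (n < N)%N -> (trunc N f)`_n = f n.
Proof. by move=> ltnN; rewrite coef_poly ltnN. Qed.

Lemma series_mul_eq f f' g g' n :
  (forall i, (i <= n)%N -> f i = f' i) -> (forall i, (i <= n)%N -> g i = g' i) ->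
  series_mul f g n = series_mul f' g' n.
Proof.
move=> eqf eqg; apply: eq_bigr => i _.
by rewrite eqf ?eqg ?leq_subr // -ltnS.
Qed.

Lemma series_mul_coef p p' n :
  series_mul (fun i => p`_i) (fun i => p'`_i) n = (p * p')`_n.
Proof. by rewrite coefM. Qed.

(** A coefficient of a product involves no later coefficient of the factors, so it can be computed
    in [{poly R}]. The ring laws and the multiplicativity of [dilate] are transferred from
    polynomials in this way. *)
Lemma series_mul_trunc N f g n : (n < N)%N ->
  series_mul f g n = (trunc N f * trunc N g)`_n.
Proof.
move=> ltnN; rewrite -series_mul_coef; apply: series_mul_eq => i lein.
all: by rewrite coef_trunc // (leq_ltn_trans lein).
Qed.

Fact series_addA : associative series_add.
Proof. by move=> f g h; apply/funext => n; rewrite /series_add addrA. Qed.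
Fact series_addC : commutative series_add.
Proof. by move=> f g; apply/funext => n; rewrite /series_add addrC. Qed.
Fact series_add0 : left_id series_zero series_add.
Proof. by move=> f; apply/funext => n; rewrite /series_add add0r. Qed.
Fact series_addN : left_inverse series_zero series_opp series_add.
Proof. by move=> f; apply/funext => n; rewrite /series_add addNr. Qed.

HB.instance Definition _ := GRing.isZmodule.Build (series R)
  series_addA series_addC series_add0 series_addN.

Fact series_mulC : commutative series_mul.
Proof.
move=> f g; apply/funext => n.
by rewrite !(@series_mul_trunc n.+1) // mulrC.
Qed.

Fact series_mulA : associative series_mul.
Proof.
move=> f g h; apply/funext => n.
pose T := trunc n.+1; pose c (p : {poly R}) : series R := fun i => p`_i.
have cT f' i : (i <= n)%N -> f' i = c (T f') i by move=> ?; rewrite /c coef_trunc.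
have cM f1 f2 i : (i <= n)%N -> series_mul f1 f2 i = c (T f1 * T f2) i.
  by move=> ?; rewrite /c -series_mul_trunc.
rewrite (series_mul_eq (cT f) (cM g h)) (series_mul_eq (cM f g) (cT h)).
by rewrite !series_mul_coef mulrA.
Qed.

Fact series_mul1 : left_id series_one series_mul.
Proof.
move=> f; apply/funext => n; rewrite /series_mul big_ord_recl big1 => [|i _].
  by rewrite mul1r addr0 subn0.
by rewrite mul0r.
Qed.

Fact series_mulDl : left_distributive series_mul series_add.
Proof.
move=> f g h; apply/funext => n.
by rewrite /series_add -big_split /=; apply: eq_bigr => i _; rewrite mulrDl.
Qed.

Fact series_one_neq0 : series_one != series_zero.
Proof.
by apply/eqP => /(congr1 (fun f => f 0%N)) /eqP; rewrite /series_one oner_eq0.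
Qed.

HB.instance Definition _ := GRing.Zmodule_isComNzRing.Build (series R)
  series_mulA series_mulC series_mul1 series_mulDl series_one_neq0.

Lemma seriesD f g n : (f + g) n = f n + g n. Proof. by []. Qed.
Lemma series1 n : (1 : series R) n = (n == 0%N)%:R. Proof. by []. Qed.
Lemma seriesM f g n : (f * g) n = \sum_(i < n.+1) f i * g (n - i)%N.
Proof. by []. Qed.

(** This lets a finite product stand for an infinite one as soon as both agree up to degree [n]. *)
Lemma seriesM_eq f f' g g' n :
  (forall i, (i <= n)%N -> f i = f' i) -> (forall i, (i <= n)%N -> g i = g' i) ->
  (f * g) n = (f' * g') n.
Proof. exact: series_mul_eq. Qed.

Lemma seriesX_eq f f' k n :
  (forall i, (i <= n)%N -> f i = f' i) -> (f ^+ k) n = (f' ^+ k) n.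
Proof.
move=> eqf; elim: k n eqf => [|k IHk] n eqf; first by rewrite !expr0.
rewrite !exprS; apply: seriesM_eq => // i lein; apply: IHk => j leji.
exact/eqf/(leq_trans leji).
Qed.

Definition of_poly p : series R := fun n => p`_n.

Fact of_poly_zmod_morphism : zmod_morphism of_poly.
Proof. by move=> p p'; apply/funext => n; rewrite /of_poly coefB. Qed.
Fact of_poly_monoid_morphism : monoid_morphism of_poly.
Proof.
split; first by apply/funext => n; rewrite /of_poly coef1.
by move=> p p'; apply/funext => n; rewrite /of_poly -series_mul_coef.
Qed.
HB.instance Definition _ :=
  GRing.isZmodMorphism.Build {poly R} (series R) of_poly of_poly_zmod_morphism.
HB.instance Definition _ :=
  GRing.isMonoidMorphism.Build {poly R} (series R) of_poly of_poly_monoid_morphism.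

Definition qvar : series R := of_poly 'X.

Lemma qXnM k f n : (qvar ^+ k * f) n = if (n < k)%N then 0 else f (n - k)%N.
Proof.
have -> : (qvar ^+ k * f) n = (of_poly 'X^k * of_poly (trunc n.+1 f)) n.
  rewrite /qvar -rmorphXn; apply: seriesM_eq => // i lein.
  by rewrite /of_poly coef_trunc.
rewrite -rmorphM [LHS]coefXnM; case: ltnP => // _.
by rewrite coef_trunc // ltnS leq_subr.
Qed.

(** The substitution of q^k for q. *)
Definition dilate k f : series R := fun n => if (k %| n)%N then f (n %/ k)%N else 0.

Lemma dilate_trunc k f N n : (0 < k)%N -> (n < N)%N ->
  dilate k f n = of_poly (trunc N f \Po 'X^k) n.
Proof.
move=> k_gt0 ltnN; rewrite /of_poly coef_comp_poly_Xn // /dilate.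
by case: ifP => // _; rewrite coef_trunc // (leq_ltn_trans _ ltnN) ?leq_div.
Qed.

Lemma dilateM k f g : (0 < k)%N -> dilate k (f * g) = dilate k f * dilate k g.
Proof.
move=> k_gt0; apply/funext => n.
rewrite (dilate_trunc _ k_gt0 (leqnn _)).
transitivity (of_poly ((trunc n.+1 f * trunc n.+1 g) \Po 'X^k) n).
  rewrite /of_poly !coef_comp_poly_Xn //; case: ifP => // _.
  have lt_n : (n %/ k < n.+1)%N by rewrite ltnS leq_div.
  by rewrite coef_trunc //; apply: series_mul_trunc.
rewrite comp_polyM rmorphM; apply: seriesM_eq => i lein.
all: by apply/esym/dilate_trunc.
Qed.

Lemma dilate1 k : (0 < k)%N -> dilate k 1 = 1.
Proof.
move=> k_gt0; apply/funext => n; rewrite /dilate !series1.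
case: ifP => [/dvdnP[m ->]|]; first by rewrite mulnK // muln_eq0 (gtn_eqF k_gt0) orbF.
by case: n => //; rewrite dvdn0.
Qed.

Lemma dilateX k f m : (0 < k)%N -> dilate k (f ^+ m) = dilate k f ^+ m.
Proof.
move=> k_gt0; elim: m => [|m IHm]; first by rewrite !expr0 dilate1.
by rewrite !exprS dilateM // IHm.
Qed.

(** The operator U of the overview, for general [k]. *)
Definition decimate k f : series R := fun n => f (k * n)%N.

Lemma decimateD k f g : decimate k (f + g) = decimate k f + decimate k g.
Proof. by []. Qed.

Lemma decimate_dilate k f : (0 < k)%N -> decimate k (dilate k f) = f.
Proof.
by move=> k_gt0; apply/funext => n; rewrite /decimate /dilate dvdn_mulr ?mulKn.
Qed.

(** A factor in q^k comes out of U: in the convolution at [k * n] only the indices [k * j]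
    contribute. *)
Lemma decimateM k f g : (0 < k)%N ->
  decimate k (dilate k f * g) = f * decimate k g.
Proof.
move=> k_gt0; apply/funext => n; rewrite /decimate !seriesM.
rewrite (bigID (fun i : 'I__ => k %| i)%N) /= [X in _ + X]big1 => [|i /negPf ndvd]; last first.
  by rewrite /dilate ndvd mul0r.
rewrite addr0 /dilate.
pose F j := f j * g (k * n - k * j)%N.
rewrite [RHS](eq_bigr (fun j : 'I_n.+1 => F j)) => [|j _]; last by rewrite /F mulnBr.
have lt_h (j : 'I_n.+1) : (k * j < (k * n).+1)%N by rewrite ltnS leq_pmul2l // -ltnS.
have lt_h' (i : 'I_(k * n).+1) : (i %/ k < n.+1)%N.
  by rewrite ltnS -(leq_pmul2l k_gt0) mulnC (leq_trans (leq_trunc_div _ _)) // -ltnS.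
rewrite (reindex_onto (fun j => Ordinal (lt_h j)) (fun i => Ordinal (lt_h' i))) /=.
  apply: eq_big => [j|j]; first by rewrite dvdn_mulr //= -val_eqE /= mulKn ?eqxx.
  by move=> _; rewrite dvdn_mulr //= mulKn.
by move=> i dvdi; apply: val_inj; rewrite /= mulnC divnK.
Qed.

End SeriesRing.

(** * Finite forms of the pentagonal and triangular theta series *)

Section FiniteThetaIdentities.

Variable R : comNzRingType.
Implicit Types (x : R) (n : nat).

(** The quotient (x;x)_n / (x;x)_j of Pochhammer symbols, written without division. *)
Definition qprod x j n := \prod_(j.+1 <= i < n.+1) (1 - x ^+ i).

Lemma qprodSr x j n : (j <= n)%N -> qprod x j n.+1 = qprod x j n * (1 - x ^+ n.+1).
Proof. by move=> lejn; rewrite /qprod big_nat_recr. Qed.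

Lemma qprodSl x j n : (j < n)%N -> qprod x j n = (1 - x ^+ j.+1) * qprod x j.+1 n.
Proof. by move=> ltjn; rewrite /qprod big_ltn. Qed.

Lemma qprodnn x n : qprod x n n = 1.
Proof. by rewrite /qprod big_geq. Qed.

(** Shanks' finite form of Euler's pentagonal number theorem: k^2 + 'C(k, 2) and k^2 + 'C(k + 1, 2)
    are k(3k - 1)/2 and k(3k + 1)/2. By induction on [n], the increment of the left side being a
    telescoping sum. *)
Lemma shanks_pentagonal x n :
  \sum_(0 <= j < n.+1) (-1) ^+ j * qprod x j n * x ^+ (n * j + 'C(j.+1, 2)) =
  1 + \sum_(1 <= k < n.+1)
        (-1) ^+ k * (x ^+ (k ^ 2 + 'C(k, 2)) + x ^+ (k ^ 2 + 'C(k.+1, 2))).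
Proof.
elim: n => [|n IHn].
  by rewrite big_nat1 big_geq // qprodnn !mulr1 !addr0.
rewrite [in RHS]big_nat_recr //= addrA -IHn big_nat_recr //=.
rewrite qprodnn mulr1.
(* Telescoping certificate: the summands for [n.+1] and [n] differ by [G j.+1 - G j]. Of the two new
   pentagonal terms, [G n.+1] gives the first, and the summand [j = n.+1] is the second. *)
pose G j := if j is j'.+1 then
  - ((-1) ^+ j' * qprod x j' n * x ^+ ('C(j'.+1, 2) + n.+1 * j'.+1)) else 0.
suff -> : \sum_(0 <= j < n.+1)
            (-1) ^+ j * qprod x j n.+1 * x ^+ (n.+1 * j + 'C(j.+1, 2)) =
   \sum_(0 <= j < n.+1) (-1) ^+ j * qprod x j n * x ^+ (n * j + 'C(j.+1, 2)) + G n.+1.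
  rewrite /G qprodnn mulr1.
  have -> : (n.+1 ^ 2 + 'C(n.+1, 2) = 'C(n.+1, 2) + n.+1 * n.+1)%N by lia.
  have -> : (n.+1 ^ 2 + 'C(n.+2, 2) = n.+1 * n.+1 + 'C(n.+2, 2))%N by lia.
  by rewrite exprS; ring.
apply/eqP; rewrite addrC -subr_eq -sumrB -[G _]subr0; apply/eqP.
apply: telescope_sumr_eq => // j /andP[_ lt_jn].
rewrite qprodSr //; case: j lt_jn => [|j] lt_jn /=.
  by rewrite !muln0 muln1 (@bin_small 1 2) //=; ring.
rewrite (@qprodSl x j n lt_jn) !(binS j.+1 1) !bin1.
move: 'C(j.+1, 2) (qprod x j.+1 n) => b Q.
have -> : (n.+1 * j.+1 = n * j.+1 + j.+1)%N by lia.
have -> : (n.+1 * j.+2 = n * j.+1 + n + j.+2)%N by lia.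
rewrite !exprD !exprS; ring.
Qed.

Definition oddprod x n := \prod_(0 <= i < n) (1 - x ^+ i.*2.+1).

Lemma oddprodS x n : oddprod x n.+1 = oddprod x n * (1 - x ^+ n.*2.+1).
Proof. by rewrite /oddprod big_nat_recr. Qed.

(** Shanks' finite form of Gauss' product for the triangular theta series, with the odd factors of
    the denominator multiplied out. Again the induction step telescopes. *)
Lemma shanks_triangular x n :
  \sum_(0 <= s < n) qprod (x ^+ 2) s n * oddprod x s * x ^+ (s * n.*2.+1) =
  oddprod x n * \sum_(0 <= s < n.*2) x ^+ 'C(s.+1, 2).
Proof.
elim: n => [|n IHn]; first by rewrite !big_geq // mulr0.
rewrite doubleS !big_nat_recr //= oddprodS -addrA mulrDr [X in _ = X + _]mulrAC -IHn.
rewrite qprodSr // qprodnn mul1r.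
(* Telescoping certificate: the summand for [n.+1] minus [1 - x ^+ n.*2.+1] times that for [n] is
   [H s.+1 - H s]. The first factor makes [H 0] vanish. *)
pose H s := (1 - (x ^+ 2) ^+ s) * qprod (x ^+ 2) s n * oddprod x s * x ^+ (s * n.*2.+1).
have e1 : x ^+ n.*2.+1 = x * x ^+ n ^+ 2 by rewrite exprS -muln2 exprM.
have e2 s : (x ^+ 2) ^+ s = x ^+ s ^+ 2 by rewrite -!exprM mulnC.
have e3 s : x ^+ (s * n.*2.+3) = x ^+ (s * n.*2.+1) * x ^+ s ^+ 2.
  by rewrite -!exprM -exprD; congr (_ ^+ _); lia.
have e4 s : x ^+ (s.+1 * n.*2.+1) = x ^+ (s * n.*2.+1) * (x * x ^+ n ^+ 2).
  by rewrite -e1 -exprD; congr (_ ^+ _); lia.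
suff -> : \sum_(0 <= s < n)
    qprod (x ^+ 2) s n.+1 * oddprod x s * x ^+ (s * n.*2.+3) =
  (\sum_(0 <= s < n) qprod (x ^+ 2) s n * oddprod x s * x ^+ (s * n.*2.+1)) *
    (1 - x ^+ n.*2.+1) + H n.
  have -> : 'C(n.*2.+1, 2) = (n * n.*2.+1)%N.
    by have := mul_bin_diag n.*2.+1 1; rewrite bin1; lia.
  have -> : 'C(n.*2.+2, 2) = (n.+1 * n.*2.+1)%N.
    by have := mul_bin_diag n.*2.+2 1; rewrite bin1; lia.
  by rewrite /H qprodnn e4 e3 !e2 e1 (exprS x n); ring.
have H0 : H 0%N = 0 by rewrite /H subrr !mul0r.
apply/eqP; rewrite addrC -subr_eq mulr_suml -sumrB -(subr0 (H n)) -{2}H0; apply/eqP.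
apply: telescope_sumr_eq => // s /andP[_ lt_sn].
rewrite /H qprodSr 1?ltnW // oddprodS (qprodSl _ lt_sn) e4 e3 e1 !e2.
have -> : x ^+ s.*2.+1 = x * x ^+ s ^+ 2 by rewrite exprS -muln2 exprM.
rewrite (exprS x n); ring.
Qed.

End FiniteThetaIdentities.

(** * Theta series over 'F_2 *)

Lemma natrF2 n : n%:R = (odd n)%:R :> 'F_2.
Proof. by apply/val_inj; rewrite /= !val_Fp_nat // !modn2 oddb. Qed.

Lemma addF2 (c : 'F_2) : c + c = 0.
Proof. by apply: addrr_pchar2; rewrite pchar_Fp. Qed.

Lemma series_addff (f : series 'F_2) : f + f = 0.
Proof. by apply/funext => n; apply: addF2. Qed.

Lemma polyF2_opp1 : -1 = 1 :> {poly 'F_2}.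
Proof. by apply/eqP; rewrite eq_sym -subr_eq0 opprK -polyCD addF2. Qed.

(** Frobenius: cross terms come in pairs and squaring fixes the coefficients. Hence the powers 2, 4
    and 8 of a series are dilations, which makes x^11 and x^12 accessible to theta series. *)
Lemma polyF2_sqr (p : {poly 'F_2}) : p ^+ 2 = p \Po 'X^2.
Proof.
have sqrF2 (c : 'F_2) : c ^+ 2 = c by apply/val_inj; case: c => -[|[|[]]].
elim/poly_ind: p => [|p c IHp]; first by rewrite comp_poly0 expr0n.
rewrite comp_polyD comp_polyM comp_polyX comp_polyC sqrrD -IHp exprMn.
by rewrite mulr2n -mulrDr -polyCD addF2 mulr0 addr0 -polyC_exp sqrF2.
Qed.

Lemma series_sqr (f : series 'F_2) : f ^+ 2 = dilate 2 f.
Proof.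
apply/funext => n; rewrite (dilate_trunc _ _ (ltnSn n)) // /of_poly -polyF2_sqr.
by rewrite !expr2; apply: series_mul_trunc.
Qed.

Lemma dilate_dilate k l (f : series 'F_2) : (0 < k)%N ->
  dilate k (dilate l f) = dilate (k * l) f.
Proof.
move=> k_gt0; apply/funext => n; rewrite /dilate divnMA.
case: ifP => [/dvdnP[m ->]|ndvd].
  by rewrite mulnK // (mulnC m) dvdn_pmul2l.
by case: ifP => // /(dvdn_trans (dvdn_mulr l (dvdnn k))); rewrite ndvd.
Qed.

Definition square (m : nat) := [exists u : 'I_m.+1, (u ^ 2 == m)%N].

Lemma squareP m : reflect (exists u, (u ^ 2)%N = m) (square m).
Proof.
apply: (iffP existsP) => [[u /eqP <-]|[u um]]; first by exists (u : nat).
have lt_u : (u < m.+1)%N by nia.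
by exists (Ordinal lt_u); apply/eqP.
Qed.

(** For n = k(3k - 1)/2 or k(3k + 1)/2, 24n + 1 is the square of 6k - 1 or 6k + 1; for n = k(k +
    1)/2, 8n + 1 is the square of 2k + 1. Modulo 2 the signs of Euler's theorem disappear. *)
Definition pentagonal : series 'F_2 := fun n => (square (24 * n + 1))%:R.
Definition triangular : series 'F_2 := fun n => (square (8 * n + 1))%:R.

Lemma sum_indicator (c : nat -> nat) m n K : (m <= K < n)%N ->
  (forall k, (m <= k < n)%N -> c k = (k == K)) -> (\sum_(m <= k < n) c k = 1)%N.
Proof.
move=> Kmn cE; rewrite (bigD1_seq K) ?mem_index_iota ?iota_uniq //= cE // eqxx.
rewrite big_seq_cond big1 // => k /andP[]; rewrite mem_index_iota => kmn neq_kK.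
by rewrite cE // (negPf neq_kK).
Qed.

Lemma bin2_double k : (2 * 'C(k.+1, 2) = k.+1 * k)%N.
Proof. by rewrite -(mul_bin_diag k.+1 1) bin1. Qed.

Lemma pentagonal_count N n : (n <= N)%N ->
  ((n == 0) + \sum_(1 <= k < N.+1)
     ((n == k ^ 2 + 'C(k, 2)) + (n == k ^ 2 + 'C(k.+1, 2))) =
   square (24 * n + 1))%N.
Proof.
move=> len.
have aE k : (24 * (k.+1 ^ 2 + 'C(k.+1, 2)) + 1 = (6 * k + 5) ^ 2)%N.
  by have := bin2_double k; lia.
have bE k : (24 * (k ^ 2 + 'C(k.+1, 2)) + 1 = (6 * k + 1) ^ 2)%N.
  by have := bin2_double k; lia.
case: squareP => [[u uE]|nsq]; last first.
  rewrite big_nat big1 => [|[|k] // _].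
    by case: eqP => // n0; case: nsq; exists 1%N; rewrite n0.
  case: eqP => [nE|_]; first by case: nsq; exists (6 * k + 5)%N; rewrite nE aE.
  by case: eqP => [nE|_] //; case: nsq; exists (6 * k.+1 + 1)%N; rewrite nE bE.
have eqnE a v : (24 * a + 1 = v ^ 2)%N -> (n == a) = (u == v).
  move=> av; apply/eqP/eqP => [na|uv]; last by nia.
  by apply/eqP; rewrite -(eqn_exp2r _ _ (isT : 0 < 2)%N) uE na av.
rewrite (eqnE 0 1)%N // (@eq_big_nat _ _ _ _ _ _ (fun k =>
    (u.+1 == 6 * k) + (u == 6 * k + 1)))%N => [|[|k] // _]; last first.
  rewrite (eqnE _ _ (aE k)) (eqnE _ _ (bE k.+1)); congr (nat_of_bool _ + _)%N.
  by apply/eqP/eqP; lia.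
have [u1|u1] := eqVneq u 1%N.
  by rewrite big_nat big1 // => k kP; rewrite u1; lia.
(* The root [u] is prime to 6, and both u = 6k - 1 and u = 6k + 1 are sent to k. *)
rewrite add0n; apply: (@sum_indicator _ _ _ (u.+1 %/ 6)).
  have : (u ^ 2 %% 6 = 1)%N by rewrite uE; lia.
  rewrite -modnXm; have := ltn_pmod u (isT : 0 < 6)%N.
  by move: (u %% 6)%N (divn_eq u 6) => [|[|[|[|[|[|]]]]]] //= uq _ _; nia.
move=> k kP.
have : (u ^ 2 %% 6 = 1)%N by rewrite uE; lia.
rewrite -modnXm; have := ltn_pmod u (isT : 0 < 6)%N.
by move: (u %% 6)%N (divn_eq u 6) => [|[|[|[|[|[|]]]]]] //= uq _ _; lia.
Qed.

Lemma triangular_count N n : (n < N)%N ->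
  (\sum_(0 <= s < N) (n == 'C(s.+1, 2)) = square (8 * n + 1))%N.
Proof.
move=> ltn.
have aE k : (8 * 'C(k.+1, 2) + 1 = (2 * k + 1) ^ 2)%N.
  by have := bin2_double k; lia.
case: squareP => [[u uE]|nsq]; last first.
  rewrite big1 // => s _.
  by case: eqP => // nE; case: nsq; exists (2 * s + 1)%N; rewrite nE aE.
have u_odd : odd u.
  have : odd (u ^ 2) by rewrite uE; lia.
  by rewrite oddX.
apply: (@sum_indicator _ _ _ u./2); first by nia.
move=> k _; congr nat_of_bool.
apply/eqP/eqP => [nE|kE].
  suff: u == (2 * k + 1)%N by lia.
  by rewrite -(eqn_exp2r _ _ (isT : 0 < 2)%N) uE nE aE.
have uk : u = (2 * k + 1)%N by lia.
by have := aE k; rewrite -uk uE; lia.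
Qed.

Lemma polyF2_signr k : (-1) ^+ k = 1 :> {poly 'F_2}.
Proof. by rewrite polyF2_opp1 expr1n. Qed.

(** On the left of Shanks' identity the summands with j > 0 are multiples of 'X^(N + 1), so up to
    degree [N] only the full product, j = 0, is left. *)
Lemma coef_qprod0 N n : (n <= N)%N -> (qprod 'X 0 N)`_n = pentagonal n.
Proof.
move=> len; have := congr1 (fun p : {poly 'F_2} => p`_n) (shanks_pentagonal 'X N).
rewrite big_nat_recl //= muln0 !add0n expr0 mul1r mulr1 coefD coef_sum big1_seq.
  rewrite addr0 => ->; rewrite /pentagonal -(pentagonal_count len).
  rewrite coefD coef1 natrD coef_sum natr_sum; congr (_ + _).
  by apply: eq_bigr => k _; rewrite polyF2_signr mul1r coefD !coefXn natrD.
move=> j _; rewrite coefMXn ifT //.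
by have := bin2_double j.+1; nia.
Qed.

Lemma qprod_oddprod (R : comNzRingType) (x : R) N :
  qprod (x ^+ 2) 0 N * oddprod x N = qprod x 0 N.*2.
Proof.
elim: N => [|N IHN]; first by rewrite /qprod /oddprod !big_geq ?mulr1.
rewrite doubleS !qprodSr ?oddprodS // -IHN -exprM.
by rewrite (_ : 2 * N.+1 = N.*2.+2)%N; [ring | lia].
Qed.

Lemma qprod_sqr_poly j N : qprod ('X^2 : {poly 'F_2}) j N = qprod 'X j N ^+ 2.
Proof.
rewrite /qprod -prodrXl; apply: eq_bigr => i _.
have oppE (p : {poly 'F_2}) : - p = p by rewrite -mulN1r polyF2_opp1 mul1r.
by rewrite !oppE sqrrD expr1n mulr2n -{2}[_ * _]oppE addrN addr0 -!exprM mulnC.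
Qed.

(** Multiply Shanks' triangular identity by the product of the even factors. On the right it
    completes the odd factors to the full product; on the left only s = 0 matters in low degree,
    giving the square of the even product, which is x^4 by Frobenius. *)
Lemma pentagonal_triangular : pentagonal * triangular = pentagonal ^+ 4.
Proof.
apply/funext => n; pose N := n.+1.
have := congr1 (fun p : {poly 'F_2} => (qprod ('X ^+ 2) 0 N * p)`_n) (shanks_triangular 'X N).
rewrite /= mulrA qprod_oddprod big_nat_recl //= mul0n. 
have -> : oddprod ('X : {poly 'F_2}) 0 = 1 by rewrite /oddprod big_geq.
rewrite expr0 !mulr1 mulrDr coefD mulr_sumr coef_sum big1_seq.
  rewrite addr0 !qprod_sqr_poly -expr2 -exprM => E.
  pose Q : {poly 'F_2} := qprod 'X 0 N.
  transitivity ((Q ^+ (2 * 2))`_n); last first.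
    rewrite -[LHS]/(of_poly (Q ^+ (2 * 2)) n) rmorphXn.
    by apply: seriesX_eq => i lein; apply: coef_qprod0; rewrite leqW.
  rewrite E -[RHS]/(of_poly (_ * _) n) rmorphM; apply: seriesM_eq => i lein.
    by symmetry; apply: coef_qprod0; lia.
  rewrite [RHS]coef_sum /triangular -(@triangular_count N.*2) ?natr_sum; last by lia.
  by apply: eq_bigr => k _; rewrite coefXn.
move=> s _; rewrite mulrA coefMXn ifT //; nia.
Qed.

(** * Partitions with restricted parts *)

Section RestrictedPartitions.

Local Open Scope nat_scope.
Variable a : pred nat.

Definition is_restricted_partition m n (s : seq nat) :=
  [&& sorted geq s, all (fun i => [&& 0 < i, i <= m & a i]) s & sumn s == n].

(* [fuel] is only there to make the recursion structural; [m + n] suffices. *)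
Fixpoint restricted_partitions fuel m n : seq (seq nat) :=
  if m is m'.+1 then
    if fuel is fuel'.+1 then
      restricted_partitions fuel' m' n ++
      (if a m && (m <= n)
       then map (cons m) (restricted_partitions fuel' m (n - m)) else [::])
    else [::]
  else if n == 0 then [:: [::]] else [::].

Lemma is_restricted_partition_cons m n x s :
  is_restricted_partition m n (x :: s) =
  [&& 0 < x, x <= m, a x, x <= n & is_restricted_partition x (n - x) s].
Proof.
rewrite /is_restricted_partition /=.
have -> : path geq x s = all (fun i => i <= x) s && sorted geq s.
  by rewrite path_sortedE // => i j k /= ji kj; apply: leq_trans kj ji.
case: (posnP x) => [->|x0] /=; first by rewrite !andbF.
case: (leqP x m) => [xm|_] /=; last by rewrite !andbF.
case: (a x) => /=; last by rewrite !andbF.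
have -> : (x + sumn s == n) = (x <= n) && (sumn s == n - x) by lia.
case: (x <= n); last by rewrite !andbF.
rewrite -andbA /=; case: (sorted geq s) => /=; last by rewrite !andbF.
case: (sumn s == _); rewrite ?andbF // !andbT -all_predI.
apply: eq_all => i /=; case: (a i); rewrite ?andbF ?andbT //.
by apply/idP/idP; lia.
Qed.

Lemma mem_restricted_partitions fuel m n s : m + n <= fuel ->
  (s \in restricted_partitions fuel m n) = is_restricted_partition m n s.
Proof.
elim: fuel m n s => [|fuel IH] [|m] n s le_fuel.
- case: s => [|x s]; first by rewrite /is_restricted_partition /= eq_sym; case: eqP.
  by rewrite is_restricted_partition_cons /=; case: eqP => _; case: x.
- by lia.
- case: s => [|x s]; first by rewrite /is_restricted_partition /= eq_sym; case: eqP.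
  by rewrite is_restricted_partition_cons /=; case: eqP => _; case: x.
rewrite [LHS]/= mem_cat IH; last by lia.
case: s => [|x s].
  rewrite /is_restricted_partition /= orb_idr //.
  by case: ifP => // _ /mapP[].
rewrite !is_restricted_partition_cons.
have -> : (x :: s \in (if a m.+1 && (m < n) then
     map (cons m.+1) (restricted_partitions fuel m.+1 (n - m.+1)) else [::])) =
   [&& x == m.+1, a x, x <= n & is_restricted_partition x (n - x) s].
  case: (eqVneq x m.+1) => [->|neq]; last first.
    by case: ifP => // _; apply/negP => /mapP[y _ [xm]]; rewrite xm eqxx in neq.
  rewrite andTb andbA; case: ifP => //= /andP[_ lt_mn].
  rewrite mem_map; last by move=> ? ? [].
  by apply: IH; lia.
case: (is_restricted_partition x _ s); rewrite ?andbF // !andbT.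
by case: (a x); rewrite ?andbF // ?andbT; lia.
Qed.

Lemma restricted_partitions_uniq fuel m n : m + n <= fuel ->
  uniq (restricted_partitions fuel m n).
Proof.
elim: fuel m n => [|fuel IH] [|m] n le_fuel.
- by rewrite /=; case: eqP.
- by lia.
- by rewrite /=; case: eqP.
rewrite /= cat_uniq IH; last by lia.
case: ifP => //= /andP[_ lt_mn].
rewrite map_inj_uniq => [|? ? []//]; rewrite IH ?andbT; last by lia.
apply/hasPn => _ /mapP[s _ ->]; rewrite mem_restricted_partitions; last by lia.
by rewrite is_restricted_partition_cons ltnn andbF.
Qed.

Definition nb_restricted m n := size (restricted_partitions (m + n) m n).

Lemma nb_restrictedE fuel m n : m + n <= fuel ->
  size (restricted_partitions fuel m n) = nb_restricted m n.
Proof.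
move=> le_fuel; apply: perm_size; apply: uniq_perm.
- exact: restricted_partitions_uniq.
- exact: restricted_partitions_uniq.
by move=> s; rewrite !mem_restricted_partitions.
Qed.

Lemma nb_restricted0 n : nb_restricted 0 n = (n == 0).
Proof. by rewrite /nb_restricted; case: n. Qed.

Lemma nb_restrictedS m n : nb_restricted m.+1 n = nb_restricted m n +
  (if a m.+1 && (m < n) then nb_restricted m.+1 (n - m.+1) else 0).
Proof.
rewrite [LHS]/nb_restricted /= size_cat nb_restrictedE //.
case: ifP => // /andP[_ lt_mn]; rewrite size_map nb_restrictedE //; lia.
Qed.

Lemma nb_restricted_stable m n : n <= m -> nb_restricted m n = nb_restricted n n.
Proof.
elim: m => [|m IHm]; first by rewrite leqn0 => /eqP->.
rewrite leq_eqVlt => /predU1P[->//|lt_nm].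
by rewrite nb_restrictedS ltnNge -ltnS lt_nm andbF addn0 IHm.
Qed.

End RestrictedPartitions.

(** Both numbers are sizes of lists without repetition that have the same members; the bound [n] on
    the parts is automatic, as a part is at most the sum. *)
Lemma nb_regular_partitionsE l n :
  nb_regular_partitions l n = nb_restricted (fun i => ~~ (l %| i)%N) n n.
Proof.
rewrite /nb_regular_partitions cardE -(size_map (map val \o val)).
apply: perm_size; apply: uniq_perm.
- rewrite map_inj_uniq ?enum_uniq //.
  by apply: inj_comp val_inj; apply/inj_map/val_inj.
- exact: restricted_partitions_uniq.
move=> s; rewrite mem_restricted_partitions //.
transitivity (is_partition n s && all (fun i => ~~ (l %| i)%N) s); last first.
  rewrite /is_partition /is_restricted_partition; case: (sorted geq s) => //=.
  case: eqP => [<-|]; rewrite ?andbF // !andbT -all_predI.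
  apply: eq_in_all => i i_s /=; suff -> : (i <= sumn s)%N by [].
  elim: s i_s => //= x s IHs; rewrite inE => /predU1P[->|/IHs]; lia.
apply/mapP/regular_partitionP => [[t]|[t t_in ->]]; last by exists t; rewrite ?mem_enum.
by rewrite mem_enum => t_in ->; exists t.
Qed.

Section GeneratingSeries.

Variables (R : comNzRingType) (a : pred nat).

Definition restricted_series m : series R := fun n => (nb_restricted a m n)%:R.

(** Multiplication by 1 - q^(m+1) undoes the recurrence [nb_restrictedS], which splits partitions by
    whether [m.+1] occurs as a part. *)
Lemma restricted_series_inverse m :
  restricted_series m * of_poly (\prod_(1 <= i < m.+1 | a i) (1 - 'X^i)) = 1.
Proof.
elim: m => [|m IHm].
  rewrite big_geq // rmorph1 mulr1; apply/funext => n.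
  by rewrite /restricted_series nb_restricted0.
rewrite big_mkcond big_nat_recr //= -big_mkcond rmorphM mulrCA mulrC [X in X * _]mulrC.
suff -> : of_poly (if a m.+1 then 1 - 'X^(m.+1) else 1) * restricted_series m.+1 =
          restricted_series m.
  exact: IHm.
apply/funext => n; rewrite /restricted_series.
case: ifP => am; last by rewrite rmorph1 mul1r nb_restrictedS am addn0.
rewrite rmorphB rmorph1 mulrBl mul1r rmorphXn /=.
rewrite -[LHS]/(_ n - (qvar R ^+ m.+1 * _) n) qXnM nb_restrictedS am /= ltnS.
case: leqP => [|lt]; first by rewrite addn0 subr0.
by rewrite natrD addrK.
Qed.

End GeneratingSeries.

Lemma coef_qprod_comp l N n : (0 < l)%N -> (n <= N)%N ->
  of_poly (qprod 'X 0 N \Po 'X^l) n = dilate l pentagonal n.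
Proof.
move=> l_gt0 lenN; rewrite /of_poly coef_comp_poly_Xn // /dilate.
case: ifP => // _; apply: coef_qprod0; exact: leq_trans (leq_div _ _) lenN.
Qed.

Lemma qprod_multiples l K : (0 < l)%N ->
  \prod_(1 <= i < (l * K).+1 | (l %| i)%N) (1 - 'X^i) =
  qprod 'X 0 K \Po 'X^l :> {poly 'F_2}.
Proof.
move=> l_gt0; elim: K => [|K IHK].
  by rewrite muln0 /qprod !big_geq // comp_polyC.
have lt_lK : (l * K < l * K.+1)%N by rewrite ltn_pmul2l.
rewrite (@big_cat_nat _ _ _ (l * K).+1) //=; last by rewrite ltnS ltnW.
rewrite IHK qprodSr // comp_polyM; congr (_ * _).
rewrite big_mkcond big_nat_recr //= dvdn_mulr // big_nat big1 ?mul1r => [|i /andP[lei lti]].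
  by rewrite comp_polyB comp_polyC rmorphXn /= comp_polyX exprM.
case: ifP => // /dvdnP[j iE]; move: lei lti.
by rewrite iE (mulnC j) !ltn_pmul2l //; lia.
Qed.

Definition partition_series : series 'F_2 := fun n => (nb_restricted predT n n)%:R.

Definition regular_series l : series 'F_2 := fun n => (nb_regular_partitions l n)%:R.

Lemma partition_seriesK : partition_series * pentagonal = 1.
Proof.
apply/funext => n; rewrite -(restricted_series_inverse _ predT n).
apply: seriesM_eq => i lein.
  by rewrite /partition_series /restricted_series nb_restricted_stable.
by rewrite -(coef_qprod0 lein).
Qed.

(** Split the product for x into multiples and non-multiples of [l]: the series inverts the latter,
    and the former make up x(q^l). *)
Lemma regular_seriesE l : (0 < l)%N ->
  regular_series l * pentagonal = dilate l pentagonal.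
Proof.
(* With this cut-off the multiples of [l] in the product are exactly l, 2l, ..., nl. *)
move=> l_gt0; apply/funext => n; pose N := (l * n)%N.
have lenN : (n <= N)%N by rewrite leq_pmull.
pose ndvd i := ~~ (l %| i)%N.
transitivity ((restricted_series 'F_2 ndvd N * of_poly (qprod 'X 0 N)) n).
  apply: seriesM_eq => i lein.
    rewrite /regular_series nb_regular_partitionsE /restricted_series nb_restricted_stable //.
    exact: leq_trans lein lenN.
  by rewrite -(coef_qprod0 (leq_trans lein lenN)).
rewrite /qprod (bigID ndvd) /= rmorphM mulrA restricted_series_inverse mul1r.
rewrite -(coef_qprod_comp l_gt0 (leqnn n)) -qprod_multiples //.
by under eq_bigl => i do rewrite negbK.
Qed.

(** * Counting lattice points *)

Lemma count_surj (T T' : eqType) (r : seq T) (r' : seq T') (P : pred T) (P' : pred T')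
    (f : T -> T') :
  uniq r -> uniq r' ->
  {in r &, forall x y, P x -> P y -> f x = f y -> x = y} ->
  {in r, forall x, P x -> f x \in r' /\ P' (f x)} ->
  {in r', forall y, P' y -> exists2 x, (x \in r) && P x & f x = y} ->
  count P r = count P' r'.
Proof.
move=> Ur Ur' f_inj fP fsurj; rewrite -!size_filter -(size_map f).
apply: perm_size; apply: uniq_perm; last 1 first.
- move=> y; rewrite mem_filter; apply/mapP/andP => [[x]|[P'y r'y]].
    by rewrite mem_filter => /andP[Px rx] ->; have [] := fP x rx Px.
  by have [x /andP[rx Px] <-] := fsurj y r'y P'y; exists x; rewrite // mem_filter Px.
- rewrite map_inj_in_uniq ?filter_uniq // => x y.
  by rewrite !mem_filter => /andP[Px rx] /andP[Py ry]; apply: f_inj.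
- exact: filter_uniq.
Qed.

Section LatticePoints.

Variable B : nat.
Implicit Types P Q : pred (int * int).

Definition segment : seq int := [seq i%:Z - B%:Z | i <- iota 0 B.*2.+1].

Definition box : seq (int * int) := [seq (s, t) | s <- segment, t <- segment].

Lemma mem_segment s : (s \in segment) = (- B%:Z <= s <= B%:Z).
Proof.
apply/mapP/idP => [[i]|sB]; first by rewrite mem_iota => ? ->; lia.
by exists (absz (s + B%:Z)); [rewrite mem_iota; lia | lia].
Qed.

Lemma mem_box p : (p \in box) = (- B%:Z <= p.1 <= B%:Z) && (- B%:Z <= p.2 <= B%:Z).
Proof.
case: p => s t; rewrite -!mem_segment.
by apply/allpairsP/andP => [[[s' t'] [? ? [-> ->]]]|[? ?]] //; exists (s, t).
Qed.

Lemma mem_box_sqr (p : int * int) : p.1 ^+ 2 <= B%:Z -> p.2 ^+ 2 <= B%:Z -> p \in box.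
Proof.
rewrite mem_box; case: p => s t /= s2 t2.
have aux (x : int) : x ^+ 2 <= B%:Z -> - B%:Z <= x <= B%:Z by nia.
by rewrite !aux.
Qed.

Lemma segment_uniq : uniq segment.
Proof. by rewrite map_inj_uniq ?iota_uniq // => i j; lia. Qed.

Lemma box_uniq : uniq box.
Proof. by apply: allpairs_uniq; rewrite ?segment_uniq // => -[? ?] [? ?]. Qed.

Definition nsol P := count P box.

Lemma eq_nsol P Q : P =1 Q -> nsol P = nsol Q.
Proof. by move=> eqPQ; apply: eq_count. Qed.

Lemma nsol_split P Q : 
  nsol P = (nsol [pred p | P p && Q p] + nsol [pred p | P p && ~~ Q p])%N.
Proof.
rewrite /nsol; elim: box => //= p r ->.
by rewrite addnACA; congr (_ + _)%N; case: (P p); case: (Q p).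
Qed.

(** Under this condition [nsol] counts all integer solutions, so that bijections need not mention
    the box. *)
Definition bounded P := forall p, P p -> p \in box.

Lemma nsol_bij P Q f g : bounded P -> bounded Q ->
  (forall p, P p -> Q (f p) /\ g (f p) = p) ->
  (forall p, Q p -> P (g p) /\ f (g p) = p) ->
  nsol P = nsol Q.
Proof.
move=> bP bQ fP gQ; apply: (@count_surj _ _ _ _ _ _ f) box_uniq box_uniq _ _ _.
- by move=> x y _ _ /fP[_ {2}<-] /fP[_ {2}<-] ->.
- by move=> x _ /fP[Qx _]; split=> //; apply: bQ.
- by move=> y _ /gQ[Px <-]; exists (g y); rewrite // Px bP.
Qed.

Lemma nsol0 P : (forall p, ~~ P p) -> nsol P = 0%N.
Proof.
by move=> P0; rewrite -(count_pred0 box); apply: eq_count => p; rewrite /= (negPf (P0 p)).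
Qed.

Lemma nsol_bool P (b : bool) : bounded P ->
  (forall p p', P p -> P p' -> p = p') -> reflect (exists p, P p) b -> nsol P = b.
Proof.
move=> bP P1 [[p Pp]|nP]; last by apply: nsol0 => p; apply/negP => Pp; apply: nP; exists p.
transitivity (count_mem p box); last by rewrite count_uniq_mem ?box_uniq // bP.
by apply: eq_count => p' /=; apply/idP/eqP => [Pp'|-> //]; apply: P1.
Qed.

Lemma nsol_sign1 P : bounded P -> (forall s t, P (- s, t) = P (s, t)) ->
  nsol P = (nsol [pred p | P p && (p.1 == 0)]%R + nsol [pred p | P p && (0 < p.1)]%R * 2)%N.
Proof.
move=> bP PN; rewrite (nsol_split P [pred p | p.1 == 0]); congr (_ + _)%N.
rewrite (nsol_split _ [pred p | 0 < p.1]) muln2 -addnn; congr (_ + _)%N.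
  by apply: eq_nsol => p /=; lia.
apply: (@nsol_bij _ _ (fun p => (- p.1, p.2)) (fun p => (- p.1, p.2))).
- by move=> p /= /andP[/andP[/bP]].
- by move=> p /= /andP[/bP].
- by move=> -[s t] /=; rewrite PN opprK; case: (P (s, t)) => //= H; split=> //; lia.
- by move=> -[s t] /=; rewrite PN opprK; case: (P (s, t)) => //= H; split=> //; lia.
Qed.

Lemma nsol_sign2 P : bounded P -> (forall s t, P (s, - t) = P (s, t)) ->
  nsol P = (nsol [pred p | P p && (p.2 == 0)]%R + nsol [pred p | P p && (0 < p.2)]%R * 2)%N.
Proof.
move=> bP PN; pose P' : pred (int * int) := fun p => P (p.2, p.1).
have swapE Q : (forall p, Q p -> P p) -> nsol Q = nsol (fun p => Q (p.2, p.1)).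
  move=> QP; apply: (@nsol_bij _ _ (fun p => (p.2, p.1)) (fun p => (p.2, p.1))).
  - by move=> p /QP/bP.
  - by move=> -[s t] /QP/bP; rewrite !mem_box andbC.
  - by case.
  - by case.
rewrite (swapE P) // (swapE [pred p | P p && (p.2 == 0)]); last by move=> p /= /andP[].
rewrite (swapE [pred p | P p && (0 < p.2)]); last by move=> p /= /andP[].
apply: (nsol_sign1 (P := P')) => [|s t]; last exact: PN.
by move=> -[s t] /bP; rewrite !mem_box andbC.
Qed.

Definition positive : pred (int * int) := fun p => (0 < p.1) && (0 < p.2).

(** Sign changes have orbits of size 4 off the axes and of size 2 on the axes away from the
    origin. *)
Lemma nsol_signs P : bounded P ->
  (forall s t, P (- s, t) = P (s, t)) -> (forall s t, P (s, - t) = P (s, t)) ->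
  ~~ P (0, 0) ->
  (nsol P = nsol [pred p | P p && (0 < p.1) && (p.2 == 0)]%R * 2 +
            nsol [pred p | P p && (p.1 == 0) && (0 < p.2)]%R * 2 +
            nsol [pred p | P p && positive p]%R * 4)%N.
Proof.
move=> bP P1 P2 P00; rewrite nsol_sign1 //.
rewrite (nsol_sign2 (P := [pred p | P p && (p.1 == 0)])); last 2 first.
- by move=> p /andP[/bP].
- by move=> s t /=; rewrite P2.
rewrite (nsol_sign2 (P := [pred p | P p && (0 < p.1)])); last 2 first.
- by move=> p /andP[/bP].
- by move=> s t /=; rewrite P2.
rewrite (nsol0 (P := [pred p | P p && (p.1 == 0) && (p.2 == 0)])) => [|[s t] /=]; last first.
  by apply/negP => /andP[/andP[Pst /eqP s0] /eqP t0]; move: P00; rewrite -{1}s0 -t0 Pst.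
rewrite (eq_nsol (P := [pred p | P p && positive p])
  (Q := [pred p | P p && (0 < p.1) && (0 < p.2)])) => [|p /=]; last by rewrite andbA.
by rewrite add0n mulnDl -mulnA addnA [in LHS](addnC (_ * 2)%N).
Qed.

Definition positives (P : pred (int * int)) : nat := nsol [pred p | P p && positive p].

End LatticePoints.

(** [theta 24] is [pentagonal] and [theta 8] is [triangular]; their products are treated
    together. *)
Definition theta c : series 'F_2 := fun n => (square (c * n + 1))%:R.

Lemma Posz_sqr n : n%:Z ^+ 2 = (n ^ 2)%N.
Proof. by rewrite expr2 -PoszM mulnn. Qed.

Lemma sqr_mod1P c (u : int) : (1 < c)%N -> 0 < u -> (u ^+ 2 %% c)%Z == 1 ->
  exists2 u0, u = u0%:Z & (u0 ^ 2 = c * (u0 ^ 2 %/ c) + 1)%N.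
Proof.
case: u => // u0 c1 u_gt0 /eqP u1; exists u0 => //.
have {}u1 : (u0 ^ 2 %% c = 1)%N.
  by apply/eqP; rewrite -eqz_nat -modz_nat -Posz_sqr u1.
by rewrite {1}(divn_eq (u0 ^ 2) c) u1 mulnC.
Qed.

(** A nonzero term at index i comes from i = k(u^2 - 1)/c and n - i = l(v^2 - 1)/d, with u and v
    unique once they are positive. The equation is the sum of these two with denominators
    cleared. *)
Lemma coef_theta_mul B c d k l n : (1 < c)%N -> (1 < d)%N -> (0 < k)%N -> (0 < l)%N ->
  (c * n + 1 <= B)%N -> (d * n + 1 <= B)%N ->
  (dilate k (theta c) * dilate l (theta d)) n =
  (nsol B [pred p | [&& (p.1 ^+ 2 %% c)%Z == 1, (p.2 ^+ 2 %% d)%Z == 1,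
     (d * k)%N%:Z * (p.1 ^+ 2 - 1) + (c * l)%N%:Z * (p.2 ^+ 2 - 1) == (c * d * n)%N%:Z
     & positive p]])%:R.
Proof.
move=> c1 d1 k0 l0 cB dB.
have [c0 d0] : (0 < c /\ 0 < d)%N by lia.
pose T i := [&& k %| i, square (c * (i %/ k) + 1), l %| n - i
  & square (d * ((n - i) %/ l) + 1)]%N.
transitivity ((count T (iota 0 n.+1))%:R : 'F_2).
  rewrite -sum1_count big_mkcond natr_sum -[iota 0 n.+1]/(index_iota 0 n.+1) big_mkord.
  rewrite seriesM; apply: eq_bigr => i _; rewrite /dilate /T /theta.
  case: (k %| i)%N; rewrite ?mul0r //; case: (l %| n - i)%N; rewrite /= ?andbF ?mulr0 //.
  by case: square; case: square; rewrite ?mulr0 ?mul0r ?mulr1.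
congr (_%:R); symmetry.
have mainP p : [&& (p.1 ^+ 2 %% c)%Z == 1, (p.2 ^+ 2 %% d)%Z == 1,
     (d * k)%N%:Z * (p.1 ^+ 2 - 1) + (c * l)%N%:Z * (p.2 ^+ 2 - 1) == (c * d * n)%N%:Z
     & positive p] -> exists u v, let a := (u ^ 2 %/ c)%N in let b := (v ^ 2 %/ d)%N in
   [/\ p = (u%:Z, v%:Z), (u ^ 2 = c * a + 1)%N, (v ^ 2 = d * b + 1)%N & (k * a + l * b = n)%N].
  case: p => s t /and4P[/= s1 t1 st /andP[/= s_gt0 t_gt0]].
  have [u uE u2] := sqr_mod1P c1 s_gt0 s1; have [v vE v2] := sqr_mod1P d1 t_gt0 t1.
  exists u, v; split; rewrite ?uE ?vE //.
  move/eqP: st => st; rewrite uE vE !Posz_sqr u2 v2 !PoszD !addrK -!PoszM -PoszD in st.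
  case: st => st.
  apply/eqP; rewrite -(eqn_pmul2l (m := c * d)) ?muln_gt0 ?c0 // -st; apply/eqP; ring.
apply: (@count_surj _ _ _ _ _ _ (fun p => (k * (`|p.1| ^ 2 %/ c)))%N)
  (box_uniq B) (iota_uniq _ _) _ _ _.
- move=> p p' _ _ /mainP[u [v /= [-> u2 v2 E]]] /mainP[u' [v' /= [-> u2' v2' E']]].
  move=> /eqP; rewrite eqn_pmul2l // => /eqP Eu.
  have Ev : (v ^ 2 %/ d = v' ^ 2 %/ d)%N.
    by apply/eqP; rewrite -(eqn_pmul2l l0) -(eqn_add2l (k * (u ^ 2 %/ c))) E Eu E'.
  have sqr_inj (m m' : nat) : (m ^ 2 = m' ^ 2)%N -> m = m'.
    by move/eqP; rewrite eqn_exp2r // => /eqP.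
  have -> : u = u' by apply: sqr_inj; rewrite u2 Eu -u2'.
  by have -> : v = v' by apply: sqr_inj; rewrite v2 Ev -v2'.
- move=> p _ Pp; rewrite mem_iota add0n ltnS.
  have [u [v /= [-> u2 v2 E]]] := mainP p Pp; rewrite /T.
  rewrite dvdn_mulr // mulKn //.
  have -> : (n - k * (u ^ 2 %/ c) = l * (v ^ 2 %/ d))%N by rewrite -E addKn.
  rewrite dvdn_mulr // mulKn // -u2 -v2; split; first by rewrite -E leq_addr.
  by rewrite /=; apply/andP; split; apply/squareP; [exists u | exists v].
- move=> i; rewrite mem_iota add0n ltnS => /andP[_ lein].
  case/and4P=> /dvdnP[a iE]; rewrite iE mulnK // => /squareP[u u2].
  case/dvdnP=> b iE'; rewrite iE' mulnK // => /squareP[v v2].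
  have nE : (n = a * k + b * l)%N by rewrite -iE' -iE subnKC.
  have div1 e x : (1 < e)%N -> ((e * x + 1) %/ e = x)%N.
    by move=> e1; rewrite mulnC divnMDl ?divn_small ?addn0 //; lia.
  exists (u%:Z, v%:Z); last by rewrite /= u2 div1 // mulnC.
  have an : (a <= n)%N by rewrite nE; nia.
  have bn : (b <= n)%N by rewrite nE; nia.
  rewrite mem_box /= !Posz_sqr u2 v2; apply/andP; split.
    have : (u <= B)%N by nia.
    have : (v <= B)%N by nia.
    by lia.
  rewrite !PoszD !addrK -!PoszD !modz_nat (mulnC c a) (mulnC d b) !modnMDl !modn_small //=.
  apply/andP; split; first by apply/eqP; rewrite nE; congr Posz; ring.
  by apply/andP; split=> /=; nia.
Qed.

(** * Elements of norm M and 3M in Z[(1 + sqrt(-11))/2] *)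

Definition oddz (t : int) := (t %% 2)%Z == 1.
Definition coprime6 (t : int) := oddz t && ((t %% 3)%Z != 0).

Lemma oddzN t : oddz (- t) = oddz t.
Proof. by rewrite /oddz; lia. Qed.

Lemma oddz_sqr t : oddz (t ^+ 2) = oddz t.
Proof.
rewrite /oddz; have := divz_eq t 2; have : (t %% 2 = 0 \/ t %% 2 = 1)%Z by lia.
by move: (t %/ 2)%Z => a [->|->] ->; lia.
Qed.

Lemma prime_modz_mul (p : nat) (s t m : int) : prime p -> s * t = p%:Z * m ->
  (s %% p)%Z = 0 \/ (t %% p)%Z = 0.
Proof.
move=> p_prime E; have : (p %| s * t)%Z by rewrite E dvdz_mulr ?dvdzz.
rewrite dvdzE abszM Euclid_dvdM // => /orP[] dvdp; [left | right].
all: exact/dvdz_mod0P.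
Qed.

Lemma odd_factor (k m u v : int) : (k %% 2)%Z = 1 -> (v %% 2)%Z = 1 ->
  k * (u ^+ 2 + 11 * v ^+ 2) = 2 * m -> (u %% 2)%Z = 1.
Proof.
move=> k_odd v_odd E; have [//|u_even] : (u %% 2)%Z = 1 \/ (u %% 2)%Z = 0 by lia.
have kE : k = 2 * (k %/ 2)%Z + 1 by lia.
have vE : v = 2 * (v %/ 2)%Z + 1 by lia.
have uE : u = 2 * (u %/ 2)%Z by lia.
by rewrite kE vE uE in E; lia.
Qed.

Section Norm11.

Variable B : nat.

(* With w = (1 + sqrt(-11))/2, [norm11 1] prescribes the norm of p.1 + p.2 w, and [form11 1]
   prescribes 4 times the norm of (p.1 + p.2 sqrt(-11))/2. *)
Definition form11 (k m : int) : pred (int * int) :=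
  fun p => k * (p.1 ^+ 2 + 11 * p.2 ^+ 2) == m.

Definition norm11 (k m : int) : pred (int * int) :=
  fun p => k * (p.1 ^+ 2 + p.1 * p.2 + 3 * p.2 ^+ 2) == m.

Lemma form11_bounded k m p : 0 < k -> m <= B%:Z -> form11 k m p -> p \in box B.
Proof.
move=> k_gt0 mB /eqP E; apply: mem_box_sqr.
  by have := sqr_ge0 p.1; have := sqr_ge0 p.2; nia.
by have := sqr_ge0 p.1; have := sqr_ge0 p.2; nia.
Qed.

Lemma norm11_bounded k m p : 0 < k -> 12 * m <= B%:Z -> norm11 k m p -> p \in box B.
Proof.
move=> k_gt0 mB /eqP E; apply: mem_box_sqr.
  by have := sqr_ge0 (p.1 + 6 * p.2); have := sqr_ge0 p.1; nia.
by have := sqr_ge0 (2 * p.1 + p.2); have := sqr_ge0 p.2; nia.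
Qed.

(** (2s + t)^2 + 11 t^2 = 4(s^2 + st + 3t^2), and an odd second coordinate forces the first to be
    odd, so the substitution can be inverted. *)
Lemma nsol_form_norm k m (c : pred int) : 0 < k -> (k %% 2)%Z = 1 -> 12 * m <= B%:Z -> 0 <= m ->
  (forall t, c t -> (t %% 2)%Z = 1) ->
  nsol B [pred p | form11 k (4 * m) p && c p.2] =
  nsol B [pred p | norm11 k m p && c p.2].
Proof.
move=> k_gt0 k_odd mB m_ge0 c_odd.
apply: (@nsol_bij _ _ _ (fun p => (((p.1 - p.2) %/ 2)%Z, p.2)) (fun p => (2 * p.1 + p.2, p.2))).
- by move=> p /andP[/form11_bounded Pp _]; apply: Pp => //; lia.
- by move=> p /andP[/norm11_bounded Pp _]; apply: Pp.
- move=> [u v] /= /andP[/eqP/= E c_v]; have v_odd := c_odd _ c_v.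
  have [s uE] : exists s, u = 2 * s + v.
    have := @odd_factor k (2 * m) u v k_odd v_odd => uo; exists ((u - v) %/ 2)%Z; lia.
  have -> : ((u - v) %/ 2)%Z = s by rewrite uE; lia.
  by rewrite uE c_v andbT /norm11 /=; split=> //; nia.
- move=> [s t] /= /andP[/eqP/= E c_t]; rewrite c_t andbT /form11 /=.
  split; first by nia.
  by congr (_, _); lia.
Qed.

(** Both coordinates are odd, so no solution lies on an axis. *)
Lemma nsol_form_positive k m (c : pred int) : 0 < k -> m <= B%:Z ->
  (forall t, c t -> (t %% 2)%Z = 1) -> (forall t, c (- t) = c t) ->
  (k %% 2)%Z = 1 -> (m %% 2)%Z = 0 -> 
  nsol B [pred p | form11 k m p && c p.2] =
  (nsol B [pred p | (form11 k m p && c p.2) && positive p] * 4)%N.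
Proof.
move=> k_gt0 mB c_odd cN k_odd m2.
have c0 : ~~ c 0 by apply/negP => /c_odd.
rewrite nsol_signs.
- rewrite [X in (X * 2 + _ + _)%N]nsol0 ?[X in (_ + X * 2 + _)%N]nsol0 //.
    case=> s t /=; apply/negP => /andP[/andP[/andP[/eqP /= E /c_odd t_odd] /eqP s0] _].
    have : k * (s ^+ 2 + 11 * t ^+ 2) = 2 * (m %/ 2)%Z by lia.
    by move=> /(odd_factor k_odd t_odd); rewrite s0.
  case=> s t /=; apply/negP => /andP[/andP[/andP[_ ct] _] /eqP t0].
  by rewrite t0 (negPf c0) in ct.
- by move=> p /andP[/form11_bounded Pp _]; apply: Pp.
- by move=> s t /=; rewrite /form11 /= sqrrN.
- by move=> s t /=; rewrite /form11 /= sqrrN cN.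
- by rewrite /= (negPf c0) andbF.
Qed.

Variable M : int.
Hypotheses (M_gt0 : 0 < M) (M_odd : (M %% 2)%Z = 1) (M_B : 36 * M <= B%:Z).

(* In Z[w] we have 3 = w w', and an element of norm 3M whose second coordinate is prime to 3 is a
   multiple of exactly one of w and its conjugate w'. *)
Lemma norm11_mul3 :
  nsol B [pred p | norm11 1 (3 * M) p && coprime6 p.2] =
  (nsol B [pred p | norm11 1 M p && oddz (p.1 + p.2) && ((p.1 + p.2) %% 3 != 0)%Z] * 2)%N.
Proof.
rewrite (@nsol_split _ _ [pred p | ((p.1 %% 3)%Z == 0)]) muln2 -addnn.
have E1 : nsol B [pred p | norm11 1 (3 * M) p && coprime6 p.2 && ((p.1 %% 3)%Z == 0)] =
    nsol B [pred p | norm11 1 M p && oddz (p.1 + p.2) && ((p.1 + p.2) %% 3 != 0)%Z].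
  (* Division by w: 3r + tw = w(r + t - rw). *)
  apply: (@nsol_bij _ _ _ (fun p => (p.2 + (p.1 %/ 3)%Z, - (p.1 %/ 3)%Z))
                          (fun p => (- 3 * p.2, p.1 + p.2))).
  - by move=> p /= /andP[/andP[/norm11_bounded Pp _] _]; apply: Pp; lia.
  - by move=> p /= /andP[/andP[/norm11_bounded Pp _] _]; apply: Pp; lia.
  - move=> [s t] /=; rewrite /norm11 /coprime6 /oddz /= => H.
    have sE : s = 3 * (s %/ 3)%Z by lia.
    move: (s %/ 3)%Z sE H => r -> H.
    rewrite addrK -andbA; split; last by congr (_, _); lia.
    case/andP: H => /andP[/eqP E ->] _; rewrite andbT; lia.
  - move=> [s t] /=; rewrite /norm11 /coprime6 /oddz /= => H.
    have -> : (- 3 * t %/ 3)%Z = - t by lia.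
    split; last by congr (_, _); lia.
    case/andP: H => /andP[/eqP E -> ->]; rewrite !andbT; lia.
rewrite -{1}E1; congr (_ + _)%N; rewrite -E1.
(* Conjugation. By the norm equation 3 divides s(s + t), and since it does not divide t it divides
   exactly one of s and s + t. *)
apply: (@nsol_bij _ _ _ (fun p => (p.1 + p.2, - p.2)) (fun p => (p.1 + p.2, - p.2))).
- by move=> p /= /andP[/andP[/norm11_bounded Pp _] _]; apply: Pp; lia.
- by move=> p /= /andP[/andP[/norm11_bounded Pp _] _]; apply: Pp; lia.
- move=> [s t] /=; rewrite /norm11 /coprime6 /oddz /= => H.
  split; last by congr (_, _); lia.
  case/andP: H => /andP[/eqP E /andP[t2 t3]] s3.
  have : s * (s + t) = 3 * (M - t ^+ 2) by lia.
  by move/(@prime_modz_mul 3 _ _ _ isT); lia.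
- move=> [s t] /=; rewrite /norm11 /coprime6 /oddz /= => H.
  split; last by congr (_, _); lia.
  case/andP: H => /andP[/eqP E /andP[t2 t3]] s3.
  by lia.
Qed.

(** s + 2rw = (s + r) + r sqrt(-11). *)
Lemma norm11_even :
  nsol B [pred p | norm11 1 M p && ~~ oddz p.2] = nsol B (form11 1 M).
Proof.
apply: (@nsol_bij _ _ _ (fun p => (p.1 + (p.2 %/ 2)%Z, (p.2 %/ 2)%Z))
                        (fun p => (p.1 - p.2, 2 * p.2))).
- by move=> p /= /andP[/norm11_bounded Pp _]; apply: Pp; lia.
- by move=> p /form11_bounded Pp; apply: Pp; lia.
- move=> [s t] /=; rewrite /norm11 /form11 /oddz /= => /andP[/eqP E t2].
  have tE : t = 2 * (t %/ 2)%Z by lia.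
  by move: (t %/ 2)%Z tE E => r -> E; split; [lia | congr (_, _); lia].
- move=> [s t] /=; rewrite /norm11 /form11 /oddz /= => /eqP E.
  have -> : (2 * t %/ 2)%Z = t by lia.
  by split; [lia | congr (_, _); lia].
Qed.

(** Conjugation replaces s + t by s, which has the other parity when t is odd. *)
Lemma norm11_odd :
  nsol B [pred p | norm11 1 M p && oddz p.2] =
  (nsol B [pred p | norm11 1 M p && oddz p.2 && oddz (p.1 + p.2)] * 2)%N.
Proof.
rewrite (@nsol_split _ _ [pred p | oddz (p.1 + p.2)]) muln2 -addnn; congr (_ + _)%N.
apply: (@nsol_bij _ _ _ (fun p => (p.1 + p.2, - p.2)) (fun p => (p.1 + p.2, - p.2))).
- by move=> p /= /andP[/andP[/norm11_bounded Pp _] _]; apply: Pp; lia.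
- by move=> p /= /andP[/andP[/norm11_bounded Pp _] _]; apply: Pp; lia.
- move=> [s t] /=; rewrite /norm11 /oddz /= => /andP[/andP[/eqP E t2] s2].
  by split; [lia | congr (_, _); lia].
- move=> [s t] /=; rewrite /norm11 /oddz /= => /andP[/andP[/eqP E t2] s2].
  by split; [lia | congr (_, _); lia].
Qed.

(** For even t, the norm [M] being odd makes s odd, so the parity condition on s + t is automatic
    there. *)
Lemma norm11_odd_sum :
  nsol B [pred p | norm11 1 M p && oddz (p.1 + p.2)] =
  (nsol B (form11 1 M) + nsol B [pred p | norm11 1 M p && oddz p.2 && oddz (p.1 + p.2)])%N.
Proof.
rewrite (@nsol_split _ _ [pred p | oddz p.2]) addnC -norm11_even; congr (_ + _)%N.
  apply: eq_nsol => -[s t] /=; rewrite -andbA /norm11 /=; case: eqP => //= E.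
  rewrite andb_idl // /oddz => t2; have tE : t = 2 * (t %/ 2)%Z by lia.
  move: (t %/ 2)%Z tE E => r -> E.
  have := divz_eq s 2; have : (s %% 2 = 0 \/ s %% 2 = 1)%Z by lia.
  move: (s %/ 2)%Z (s %% 2)%Z => a b [->|->] sE; rewrite sE in E *; lia.
by apply: eq_nsol => -[s t] /=; rewrite -!andbA; congr (_ && _); rewrite andbC.
Qed.

(** If s + t = 3r, then s + tw = w'(-t + rw), and r has the parity of s + t. *)
Lemma norm11_odd_sum_mod3 :
  nsol B [pred p | norm11 1 M p && oddz (p.1 + p.2) && ~~ ((p.1 + p.2) %% 3 != 0)%Z] =
  nsol B [pred p | norm11 3 M p && oddz p.2].
Proof.
apply: (@nsol_bij _ _ _ (fun p => (- p.2, ((p.1 + p.2) %/ 3)%Z))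
                        (fun p => (p.1 + 3 * p.2, - p.1))).
- by move=> p /= /andP[/andP[/norm11_bounded Pp _] _]; apply: Pp; lia.
- by move=> p /= /andP[/norm11_bounded Pp _]; apply: Pp; lia.
- move=> [s t] /=; rewrite /norm11 /oddz /= => /andP[/andP[/eqP E t2] s3].
  have sE : s = 3 * ((s + t) %/ 3)%Z - t by lia.
  move: ((s + t) %/ 3)%Z sE E t2 => r -> E t2.
  by split; [lia | congr (_, _); lia].
- move=> [s t] /=; rewrite /norm11 /oddz /= => /andP[/eqP E t2].
  have -> : (s + 3 * t + - s = 3 * t) by lia.
  have -> : (3 * t %/ 3)%Z = t by lia.
  by split; [lia | congr (_, _); lia].
Qed.

(** This is [norm11_mul3] with every count expressed by positive solutions of diagonal forms and a
    common factor 4 cancelled. The terms left undoubled are the coefficients in the modular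
    equation. *)
Lemma form11_count :
  (positives B [pred p | form11 1 (12 * M) p && coprime6 p.2] +
   positives B [pred p | form11 3 (4 * M) p && oddz p.2] * 2 =
   nsol B [pred p | form11 1 M p && (0 < p.1) && (p.2 == 0)]%R +
   nsol B [pred p | form11 1 M p && (p.1 == 0) && (0 < p.2)]%R +
   positives B (form11 1 M) * 2 + positives B [pred p | form11 1 (4 * M) p && oddz p.2])%N.
Proof.
have oN := oddzN.
have oddzP t : oddz t -> (t %% 2)%Z = 1 by move/eqP.
have EU : nsol B [pred p | norm11 1 (3 * M) p && coprime6 p.2] =
    (positives B [pred p | form11 1 (12 * M) p && coprime6 p.2] * 4)%N.
  rewrite -nsol_form_norm //; try lia; last by move=> t /andP[/oddzP].
  rewrite nsol_form_positive //; try lia.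
  - by rewrite mulrA.
  - by move=> t /andP[/oddzP].
  - by move=> t; rewrite /coprime6 oddzN; congr (_ && _); lia.
have EC : nsol B [pred p | norm11 3 M p && oddz p.2] =
    (positives B [pred p | form11 3 (4 * M) p && oddz p.2] * 4)%N.
  by rewrite -nsol_form_norm ?nsol_form_positive //; lia.
have EV : nsol B [pred p | norm11 1 M p && oddz p.2] =
    (positives B [pred p | form11 1 (4 * M) p && oddz p.2] * 4)%N.
  by rewrite -nsol_form_norm ?nsol_form_positive //; lia.
have EW : nsol B (form11 1 M) =
  (nsol B [pred p | form11 1 M p && (0 < p.1) && (p.2 == 0)]%R * 2 +
   nsol B [pred p | form11 1 M p && (p.1 == 0) && (0 < p.2)]%R * 2 +
   positives B (form11 1 M) * 4)%N.
  apply: nsol_signs => [p|s t|s t|].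
  - by move/form11_bounded; apply; lia.
  - by rewrite /form11 /= sqrrN.
  - by rewrite /form11 /= sqrrN.
  - by rewrite /form11 /=; lia.
have := norm11_mul3; have := norm11_odd; have := norm11_odd_sum.
have := nsol_split B [pred p | norm11 1 M p && oddz (p.1 + p.2)]
                     [pred p | ((p.1 + p.2) %% 3 != 0)%Z].
rewrite /= norm11_odd_sum_mod3 EU EC EV EW.
move: (nsol B _) (nsol B _) (nsol B _) (nsol B _) (nsol B _).
lia.
Qed.

End Norm11.

(** * The forms 8u^2 + 3a^2 and x^2 + 96z^2 *)

(** Modulo 11 the form is 8(u - a)(u + a), because 3 = -8. *)
Lemma prime11_sqr (u a m : int) : 8 * u ^+ 2 + 3 * a ^+ 2 = 11 * m ->
  ((u - a) %% 11)%Z = 0 \/ ((u + a) %% 11)%Z = 0.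
Proof.
move=> E; have : (8 * (u - a)) * (u + a) = 11 * (m - a ^+ 2) by lia.
by move/(@prime_modz_mul 11 _ _ _ isT); lia.
Qed.

Section Forms24.

Variables (B : nat) (M : int).
Hypotheses (M_gt0 : 0 < M) (M_odd : (M %% 2)%Z = 1) (M_B : 11 * M <= B%:Z).

Definition form83 (k m : int) : pred (int * int) :=
  fun p => (k * (8 * p.1 ^+ 2 + 3 * p.2 ^+ 2) == m) && oddz p.1.

Definition form196 : pred (int * int) := fun p => p.1 ^+ 2 + 96 * p.2 ^+ 2 == M.

Lemma form83_bounded k m : 0 < k -> m <= B%:Z -> bounded B (form83 k m).
Proof.
move=> k_gt0 mB p /andP[/eqP E _]; have s2 := sqr_ge0 p.1; have t2 := sqr_ge0 p.2.
have : 8 * p.1 ^+ 2 + 3 * p.2 ^+ 2 <= m by rewrite -E ler_peMl //; lia.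
by move=> le_m; apply: mem_box_sqr; lia.
Qed.

Lemma form83_boundedI k m (c : pred (int * int)) : 0 < k -> m <= B%:Z ->
  bounded B [pred p | form83 k m p && c p].
Proof. by move=> k_gt0 mB p /andP[/form83_bounded Pp _]; apply: Pp. Qed.

Lemma form196_bounded : bounded B form196.
Proof.
move=> p /eqP E; apply: mem_box_sqr.
  by have := sqr_ge0 p.1; have := sqr_ge0 p.2; lia.
by have := sqr_ge0 p.1; have := sqr_ge0 p.2; lia.
Qed.

Lemma form83_odd2 k m p : (m %% 2)%Z = 1 -> form83 k m p -> oddz p.2.
Proof.
move=> m_odd /andP[/eqP E _]; rewrite -oddz_sqr; apply/negP => /negP t2.
have tE : p.2 ^+ 2 = 2 * (p.2 ^+ 2 %/ 2)%Z by move: t2; rewrite /oddz; lia.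
by move: E; rewrite tE; lia.
Qed.

Lemma form83_positives k m : 0 < k -> m <= B%:Z -> (m %% 2)%Z = 1 ->
  nsol B (form83 k m) = (positives B (form83 k m) * 4)%N.
Proof.
move=> k_gt0 mB m_odd; rewrite nsol_signs.
- rewrite [X in (X * 2 + _ + _)%N]nsol0 ?[X in (_ + X * 2 + _)%N]nsol0 //.
    by case=> s t /=; apply/negP => /andP[/andP[/andP[_ s_odd] /eqP s0] _]; rewrite s0 in s_odd.
  case=> s t /=; apply/negP => /andP[/andP[/(form83_odd2 m_odd) t_odd _] /eqP t0].
  by rewrite /= t0 in t_odd.
- exact: form83_bounded.
- by move=> s t; rewrite /form83 /= sqrrN oddzN.
- by move=> s t; rewrite /form83 /= sqrrN.
- by rewrite /form83 andbF.
Qed.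

(* (8u + 3a)^2 + 24 (u - a)^2 = 11 (8u^2 + 3a^2), and u - a is even. *)
Lemma form83_congruent :
  nsol B [pred p | form83 1 (11 * M) p && ((p.1 - p.2) %% 11 == 0)%Z] = nsol B form196.
Proof.
(* For u = a + 22z the image is (a + 16z, z); the identity divided by 121 becomes x^2 + 96z^2 =
   M. *)
apply: (@nsol_bij _ _ _ (fun p => (((8 * p.1 + 3 * p.2) %/ 11)%Z, ((p.1 - p.2) %/ 22)%Z))
                        (fun p => (p.1 + 6 * p.2, p.1 - 16 * p.2))).
- by apply: form83_boundedI; lia.
- exact: form196_bounded.
- move=> p /andP[Pp]; have := @form83_odd2 1 (11 * M) p _ Pp; case: p Pp => u a /=.
  rewrite /form83 /form196 /oddz /= => /andP[/eqP E u2] a2 ua.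
  have {}a2 : (a %% 2)%Z == 1 by apply: a2; lia.
  have [z uE] : exists z, u = a + 22 * z by exists ((u - a) %/ 22)%Z; lia.
  have -> : ((u - a) %/ 22)%Z = z by lia.
  have -> : ((8 * u + 3 * a) %/ 11)%Z = a + 16 * z by lia.
  by rewrite uE in E *; split; [lia | congr (_, _); lia].
- move=> [x z] /=; rewrite /form83 /form196 /= => /eqP E.
  have x2 : oddz x by rewrite -oddz_sqr /oddz; lia.
  move: x2; rewrite /oddz => x2.
  by split; [lia | congr (_, _); lia].
Qed.

(** Inclusion and exclusion over u = a and u = -a modulo 11: the sign of a exchanges the two cases,
    and both hold exactly when 11 divides u and a. *)
Lemma form83_count :
  (positives B (form83 1 (11 * M)) + positives B (form83 11 M) =
   nsol B [pred p | form196 p && (0 < p.1) && (p.2 == 0)]%R + positives B form196 * 2)%N.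
Proof.
have M11 : ((11 * M) %% 2)%Z = 1 by lia.
have E196 : nsol B form196 =
  (nsol B [pred p | form196 p && (0 < p.1) && (p.2 == 0)]%R * 2 + positives B form196 * 4)%N.
  rewrite nsol_signs.
  - rewrite [X in (_ + X * 2 + _)%N]nsol0 ?addn0 //.
    by case=> s t /=; rewrite /form196 /=; apply/negP => H; lia.
  - exact: form196_bounded.
  - by move=> s t; rewrite /form196 /= sqrrN.
  - by move=> s t; rewrite /form196 /= sqrrN.
  - by rewrite /form196 /=; lia.
have E1 := nsol_split B (form83 1 (11 * M)) [pred p | ((p.1 - p.2) %% 11 == 0)%Z].
rewrite /= form83_congruent (form83_positives _ M_B M11) // in E1.
have E2 := nsol_split B [pred p | form83 1 (11 * M) p && ((p.1 - p.2) %% 11 == 0)%Z]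
                        [pred p | ((p.1 + p.2) %% 11 == 0)%Z].
rewrite /= form83_congruent in E2.
have E3 : nsol B [pred p | form83 1 (11 * M) p && ((p.1 - p.2) %% 11 == 0)%Z &&
                  ((p.1 + p.2) %% 11 == 0)%Z] = nsol B (form83 11 M).
  apply: (@nsol_bij _ _ _ (fun p => ((p.1 %/ 11)%Z, (p.2 %/ 11)%Z))
                          (fun p => (11 * p.1, 11 * p.2))).
  - by move=> p /= /andP[/andP[/form83_bounded Pp _] _]; apply: Pp; lia.
  - by move=> p /= /form83_bounded Pp; apply: Pp; lia.
  - move=> [u a]; rewrite /form83 /oddz /= => /andP[/andP[/andP[/eqP E u2] ua ua']].
    have uE : u = 11 * (u %/ 11)%Z by lia.
    have aE : a = 11 * (a %/ 11)%Z by lia.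
    move: (u %/ 11)%Z (a %/ 11)%Z uE aE E u2 => v b -> -> E u2.
    by split; [lia | congr (_, _); lia].
  - move=> [u a]; rewrite /form83 /oddz /= => /andP[/eqP E u2].
    by split; [lia | congr (_, _); lia].
have E4 : nsol B [pred p | form83 1 (11 * M) p && ~~ ((p.1 - p.2) %% 11 == 0)%Z] =
          nsol B [pred p | form83 1 (11 * M) p && ((p.1 - p.2) %% 11 == 0)%Z &&
                  ~~ ((p.1 + p.2) %% 11 == 0)%Z].
  apply: (@nsol_bij _ _ _ (fun p => (p.1, - p.2)) (fun p => (p.1, - p.2))).
  - by apply: form83_boundedI; lia.
  - by move=> p /= /andP[/andP[/form83_bounded Pp _] _]; apply: Pp; lia.
  - move=> [u a]; rewrite /form83 /oddz /= => /andP[/andP[/eqP E u2] ua].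
    rewrite sqrrN opprK; split=> //; have := @prime11_sqr u a M; lia.
  - move=> [u a]; rewrite /form83 /oddz /= => /andP[/andP[/andP[/eqP E u2] ua ua']].
    rewrite sqrrN opprK; split=> //; lia.
have E5 : nsol B (form83 11 M) = (positives B (form83 11 M) * 4)%N.
  by apply: form83_positives; lia.
rewrite E3 E5 in E2.
rewrite E4 in E1; move: E1 E2 E196.
move: (nsol B _) (nsol B _) (nsol B _).
lia.
Qed.

End Forms24.

(** * Identities modulo 2 *)

Lemma triangularE : triangular = pentagonal ^+ 3.
Proof.
rewrite -[LHS]mul1r -partition_seriesK -mulrA pentagonal_triangular exprS mulrA.
by rewrite partition_seriesK mul1r.
Qed.

Lemma series_pow4 (f : series 'F_2) : f ^+ 4 = dilate 4 f.
Proof. by rewrite -[4%N]/(2 * 2)%N exprM !series_sqr dilate_dilate. Qed.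

Lemma series_pow8 (f : series 'F_2) : f ^+ 8 = dilate 8 f.
Proof. by rewrite -[8%N]/(2 * 4)%N exprM series_pow4 series_sqr dilate_dilate. Qed.

Lemma dilate1l (f : series 'F_2) : dilate 1 f = f.
Proof. by apply/funext => n; rewrite /dilate dvd1n divn1. Qed.

Lemma sqr_mod8 (v : int) : ((v ^+ 2 %% 8)%Z == 1) = oddz v.
Proof.
rewrite /oddz; have := divz_eq v 4; have : (0 <= v %% 4 < 4)%Z by lia.
move: (v %/ 4)%Z (v %% 4)%Z => a r r4 ->.
have : [\/ r = 0, r = 1, r = 2 | r = 3] by case: r r4 => [[|[|[|[|?]]]]|?] // _; constructor.
by case=> ->; lia.
Qed.

Lemma odd_sqr_mod8 m u : (u ^ 2 = m)%N -> odd m -> (m %% 8 = 1)%N.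
Proof.
move=> <-; rewrite oddX /= => u_odd.
have := sqr_mod8 u%:Z; rewrite /oddz Posz_sqr; lia.
Qed.

Lemma sqr_mod24 (v : int) : ((v ^+ 2 %% 24)%Z == 1) = coprime6 v.
Proof.
have -> : ((v ^+ 2 %% 24)%Z == 1) = ((v ^+ 2 %% 8)%Z == 1) && ((v ^+ 2 %% 3)%Z == 1) by lia.
rewrite sqr_mod8 /coprime6; congr (_ && _).
have := divz_eq v 3; have : (v %% 3 = 0 \/ v %% 3 = 1 \/ v %% 3 = 2)%Z by lia.
by move: (v %/ 3)%Z (v %% 3)%Z => a r [->|[|]->] ->; lia.
Qed.

Lemma nsol_square B (P : pred (int * int)) m : bounded B P ->
  (forall s, P (s, 0) = (s ^+ 2 == m%:Z)) -> (0 < m)%N ->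
  nsol B [pred p | P p && (0 < p.1) && (p.2 == 0)] = square m.
Proof.
move=> bP PE m_gt0; apply: nsol_bool.
- by move=> p /andP[/andP[/bP]].
- move=> [s t] [s' t'] /= /andP[/andP[Ps s0] /eqP t0] /andP[/andP[Ps' s0'] /eqP t0'].
  by rewrite t0 t0' !PE in Ps Ps' *; congr (_, _); nia.
apply: (iffP (squareP m)) => [[u uE]|[[s t] /= /andP[/andP[Ps s0] /eqP t0]]].
  exists (u%:Z, 0); rewrite /= PE Posz_sqr uE !eqxx andbT /=; nia.
exists `|s|%N; move: Ps; rewrite t0 PE; nia.
Qed.

Lemma nsol_square2 B (P : pred (int * int)) m : bounded B P ->
  (forall t, P (0, t) = (11 * t ^+ 2 == m%:Z)) -> (0 < m)%N ->
  nsol B [pred p | P p && (p.1 == 0) && (0 < p.2)] = (11 %| m)%N && square (m %/ 11).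
Proof.
move=> bP PE m_gt0; apply: nsol_bool.
- by move=> p /andP[/andP[/bP]].
- move=> [s t] [s' t'] /= /andP[/andP[Ps /eqP t0] s0] /andP[/andP[Ps' /eqP t0'] s0'].
  by rewrite t0 t0' !PE in Ps Ps' *; congr (_, _); nia.
apply: (iffP andP) => [[dvd /squareP[u uE]]|[[s t] /= /andP[/andP[Ps /eqP s0] t0]]].
  exists (0, u%:Z); rewrite /= PE Posz_sqr uE !eqxx /=; nia.
move: Ps; rewrite s0 PE => /eqP tE.
have mE : m = (11 * `|t| ^ 2)%N by nia.
by rewrite mE dvdn_mulr // mulKn //; split=> //; apply/squareP; exists `|t|%N.
Qed.

Local Notation x := pentagonal.
Local Notation y := (dilate 11 pentagonal).
Local Notation q := (qvar 'F_2).

(** The coefficient at q^n is [form11_count] for M = 2n + 1: x y asks for u^2 + 11v^2 = 12M, q x^3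
    y^3 for u^2 + 11v^2 = 4M, and the two twelfth powers for M or M/11 to be a square. *)
Lemma modular_equation : x * y = x ^+ 12 + q ^+ 5 * y ^+ 12 + q * (x ^+ 3 * y ^+ 3).
Proof.
have y3 : y ^+ 3 = dilate 11 triangular by rewrite triangularE dilateX.
have -> : y ^+ 12 = dilate 44 triangular.
  by rewrite -[12%N]/(3 * 4)%N exprM y3 series_pow4 dilate_dilate.
have -> : x ^+ 12 = dilate 4 triangular.
  by rewrite -[12%N]/(3 * 4)%N exprM -triangularE series_pow4.
rewrite y3 -triangularE; apply/funext => n; rewrite !seriesD qXnM.
pose M := (2 * n + 1)%N; pose B := (36 * M)%N.
have := @form11_count B M%:Z; set U := positives B _; set C := positives B _.
set S := nsol B _; set T := nsol B _; set W := positives B _; set V := positives B _.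
have -> : (x * y) n = U%:R.
  rewrite -[x in x * y]dilate1l (coef_theta_mul (B := B)) //; try lia.
  congr (_%:R); apply: eq_nsol => -[u v] /=; rewrite /form11 /=.
  by case: positive; rewrite ?andbF // !andbT -[in RHS]sqr_mod24; lia.
have -> : (q * (triangular * dilate 11 triangular)) n = V%:R.
  rewrite -[q]expr1 qXnM; case: ltnP => [n_lt1|n_gt0].
    have -> : V = 0%N; last by [].
    by apply: nsol0 => -[u v] /=; rewrite /form11 /positive /oddz /= /M; nia.
  rewrite -[triangular in triangular * _]dilate1l (coef_theta_mul (B := B)) //; try lia.
  congr (_%:R); apply: eq_nsol => -[u v] /=; rewrite /form11 /=.
  by case: positive; rewrite ?andbF // !andbT -sqr_mod8; lia.
have form_bounded : bounded B (form11 1 M%:Z) by move=> p; apply: form11_bounded; lia.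
have -> : dilate 4 triangular n = S%:R.
  have -> : S = square M.
    apply: nsol_square => // [s|]; last by rewrite /M addn1.
    by rewrite /form11 /= expr0n /= mulr0 addr0 mul1r.
  rewrite /dilate /triangular; case: ifP => [dvd4|ndvd4].
    by congr (_ _)%:R; congr square; rewrite /M; lia.
  (* Odd squares are 1 modulo 8, so 2n + 1 is not a square unless 4 divides n. *)
  by case: squareP => // -[u /odd_sqr_mod8]; rewrite /M; lia.
have -> : (if (n < 5)%N then 0 else dilate 44 triangular (n - 5)%N) = T%:R.
  have -> : T = (11 %| M)%N && square (M %/ 11).
    apply: nsol_square2 => // [s|]; last by rewrite /M addn1.
    by rewrite /form11 /= expr0n /= add0r mul1r.
  case: (boolP (11 %| M)%N) => [dvd11|ndvd11] /=; last first.
    case: ltnP => // n5; rewrite /dilate ifN //; apply: contra ndvd11; rewrite /M; lia.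
  case: (squareP (M %/ 11)) => [[u uE]|nsq].
    (* As M/11 is 1 modulo 8, 2n + 1 is 11 modulo 88, that is, n is 5 modulo 44. *)
    have := odd_sqr_mod8 uE; rewrite /M => M8.
    rewrite ltnNge (_ : 5 <= n)%N /=; last by lia.
    rewrite /dilate ifT /triangular; last by lia.
    by case: squareP => // -[]; exists u; lia.
  case: ltnP => // n5; rewrite /dilate; case: ifP => // dvd44; rewrite /triangular.
  by case: squareP => // -[u uE]; case: nsq; exists u; rewrite uE /M; lia.
move=> E; have {}E : (U + C * 2 = S + T + W * 2 + V)%N by apply: E; rewrite /B /M; lia.
have := congr1 (fun k => k%:R : 'F_2) E.
by rewrite /= !natrD !muln2 -!addnn !natrD !addF2 !addr0.
Qed.

(** Since x^11 = x(q^8) x^3, its coefficient at q^(11n) counts 8u^2 + 3a^2 = 11M with M = 24n + 1,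
    and that of q^5 y^11 at q^n counts 11(8u^2 + 3a^2) = M. So [form83_count] applies. *)
Lemma decimate_pow11 : decimate 11 (x ^+ 11) = x + q ^+ 5 * y ^+ 11.
Proof.
have -> : y ^+ 11 = dilate 88 x * dilate 11 triangular.
  by rewrite (exprD y 8 3) series_pow8 triangularE dilateX // dilate_dilate.
have -> : x ^+ 11 = dilate 8 x * dilate 1 triangular.
  by rewrite (exprD x 8 3) series_pow8 triangularE dilate1l.
apply/funext => n; rewrite /decimate seriesD qXnM.
pose M := (24 * n + 1)%N; pose B := (11 * M)%N.
have := @form83_count B M%:Z; set U := positives B _; set V := positives B _.
set S := nsol B _; set W := positives B _.
have -> : (dilate 8 x * dilate 1 triangular) (11 * n)%N = U%:R.
  rewrite (coef_theta_mul (B := B)) //; try lia.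
  congr (_%:R); apply: eq_nsol => -[u a] /=; rewrite /form83 /=.
  case: positive; rewrite ?andbF // !andbT -(sqr_mod8 u).
  have := sqr_mod8 a; rewrite -(oddz_sqr a) /oddz; lia.
have -> : x n = S%:R.
  suff -> : S = square M by [].
  apply: nsol_square => [|s|]; first by apply: form196_bounded; lia.
    by rewrite /form196 /= expr0n /= mulr0 addr0.
  by rewrite /M addn1.
have -> : (if (n < 5)%N then 0 else (dilate 88 x * dilate 11 triangular) (n - 5)%N) = V%:R.
  case: ltnP => n5.
    have -> : V = 0%N; last by [].
    apply: nsol0 => -[u a] /=; rewrite /form83 /positive /= /M; nia.
  rewrite (coef_theta_mul (B := B)) //; try lia.
  congr (_%:R); apply: eq_nsol => -[u a] /=; rewrite /form83 /=.
  case: positive; rewrite ?andbF // !andbT -(sqr_mod8 u).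
  have := sqr_mod8 a; rewrite -(oddz_sqr a) /oddz; lia.
move=> E; have {}E : (U + V = S + (W + W))%N.
  by rewrite addnn -muln2; apply: E; rewrite /B /M; lia.
have := congr1 (fun k => k%:R : 'F_2) E; rewrite !natrD addF2 addr0 => <-.
by rewrite -addrA addF2 addr0.
Qed.

(** The left side tests whether 11(12n - 1) is a square u^2; then u = 11v, and v^2 = (12n - 1)/11 is
    the square tested on the right. *)
Lemma decimate_q_sqr : decimate 11 (q * x ^+ 2) = q * y ^+ 2.
Proof.
rewrite !series_sqr dilate_dilate //; apply/funext => n.
rewrite /decimate -[q]expr1 !qXnM /dilate /pentagonal.
case: ltnP => [n0|n_gt0]; first by rewrite ifT //; lia.
have -> : (n < 1)%N = false by lia.
set a := (2 %| _)%N; set b := (22 %| _)%N; set s := square _; set t := square _.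
suff : a && s = b && t by case: a b s t => -[] [] [].
rewrite /a /b /s /t; apply/andP/andP => -[dvd /squareP[u uE]].
  have dvdu : (11 %| u ^ 2)%N by rewrite uE; lia.
  rewrite Euclid_dvdX // andbT in dvdu; case/dvdnP: dvdu uE => v -> uE.
  have vE : (11 * v ^ 2 = 12 * n - 1)%N by lia.
  have v8 : (v ^ 2 %% 8 = 1)%N by apply: (odd_sqr_mod8 erefl); lia.
  by split; [lia | apply/squareP; exists v; lia].
by split; [lia | apply/squareP; exists (11 * u)%N; lia].
Qed.

Lemma decimate_regular :
  decimate 11 (q ^+ 5 * regular_series 11) * (x ^+ 10 * y) = y + x ^+ 11.
Proof.
pose w := regular_series 11; pose P := partition_series.
have wx : w * x = y by apply: regular_seriesE.
have Py : dilate 11 P * y = 1 by rewrite -dilateM // partition_seriesK dilate1.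
have cancel_y f g : f * y = g * y -> f = g.
  by move=> fg; rewrite -[f]mulr1 -[g]mulr1 -Py !(mulrC (dilate 11 P)) !mulrA fg.
have cancel_x f g : f * x = g * x -> f = g.
  by move=> fg; rewrite -[f]mulr1 -[g]mulr1 -partition_seriesK !(mulrC P) !mulrA fg.
have modular : q ^+ 5 * y ^+ 12 = x * y + x ^+ 12 + q * (x ^+ 3 * y ^+ 3).
  rewrite modular_equation -!addrA [q * _ + _]addrC -!addrA series_addff addr0.
  by rewrite addrCA series_addff addr0.
(* After multiplication by y the modular equation applies; each of its remaining terms contains x,
   and w x = y. *)
have E : y ^+ 11 * (q ^+ 5 * w) = y + x ^+ 11 + y ^+ 3 * (q * x ^+ 2).
  apply: cancel_y; transitivity (w * (q ^+ 5 * y ^+ 12)); first by ring.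
  rewrite modular; transitivity (w * x * (y + x ^+ 11 + y ^+ 3 * (q * x ^+ 2))).
    by ring.
  by rewrite wx mulrC.
have {}E := congr1 (decimate 11) E; move: E.
rewrite !decimateD -!dilateX // !decimateM // decimate_dilate // decimate_pow11.
rewrite decimate_q_sqr addrA series_addff add0r => E.
apply: cancel_x; rewrite -/w.
transitivity (x ^+ 11 * decimate 11 (q ^+ 5 * w) * y); first by ring.
(* The modular equation, used a second time, turns this sum into x y + x^12. *)
rewrite E mulrDl; transitivity (q ^+ 5 * y ^+ 12 + q * (x ^+ 3 * y ^+ 3)); first by ring.
rewrite modular -addrA series_addff addr0; ring.
Qed.

(** x^(-10) is written as a square so that Frobenius shows it to be a series in q^2. *)
Lemma decimate_regularE : decimate 11 (q ^+ 5 * regular_series 11) =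
  (partition_series ^+ 5) ^+ 2 + x * dilate 11 partition_series.
Proof.
set P := partition_series; have Px : P * x = 1 by apply: partition_seriesK.
have Py : dilate 11 P * y = 1 by rewrite -dilateM // Px dilate1.
set W := decimate _ _; transitivity (W * (P * x) ^+ 10 * (dilate 11 P * y)).
  by rewrite Px Py expr1n !mulr1.
transitivity (W * (x ^+ 10 * y) * (P ^+ 10 * dilate 11 P)); first by ring.
rewrite decimate_regular.
transitivity ((P ^+ 5) ^+ 2 * (dilate 11 P * y) + (P * x) ^+ 10 * (x * dilate 11 P)).
  by ring.
by rewrite Px Py expr1n mulr1 mul1r.
Qed.

(** The coefficient at the odd exponent 2k + 1 sees only x/y. A nonzero term there needs 24i + 1
    square with i = 2k + 1 modulo 11, and 24(2k + 1) + 1 = 48k + 25. *)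
Lemma regular_nonresidue k :
  (forall u, u ^ 2 != 48 * k + 25 %[mod 11])%N ->
  regular_series 11 (22 * k + 6)%N = 0.
Proof.
move=> nonres; have := congr1 (fun f => f k.*2.+1) decimate_regularE.
rewrite seriesD /decimate qXnM ifN; last by rewrite -leqNgt; lia.
have -> : (11 * k.*2.+1 - 5 = 22 * k + 6)%N by lia.
move=> ->; rewrite series_sqr {1}/dilate ifN ?add0r; last by rewrite dvdn2 /= odd_double.
rewrite seriesM big1 // => -[i /= lei] _; rewrite /dilate /pentagonal.
case: ifP => [dvd11|]; last by rewrite mulr0.
case: squareP => [[u uE]|]; last by rewrite mul0r.
by have /negP[] := nonres u; rewrite uE; apply/eqP; lia.
Qed.

Local Close Scope ring_scope.

Theorem theorem3 (n B : nat) :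
  B \in [:: 28; 94; 182; 204; 226] -> nb_regular_partitions 11 (242 * n + B) = 0 %[mod 2].
Proof.
move=> B_in.
(* For these k, 48k + 25 is 7, 8, 2, 6, 10 modulo 11: the five quadratic nonresidues. *)
have [k BE kE] : exists2 k, B = 22 * k + 6 & k \in [:: 1; 4; 8; 9; 10].
  by move: B_in; rewrite !inE => /or4P[|||/orP[]] /eqP ->;
    [exists 1 | exists 4 | exists 8 | exists 9 | exists 10].
have -> : 242 * n + B = 22 * (11 * n + k) + 6 by rewrite BE; lia.
have nonres u : u ^ 2 != 48 * (11 * n + k) + 25 %[mod 11].
  rewrite -modnXm (_ : 48 * (11 * n + k) + 25 = 11 * (48 * n) + (48 * k + 25)); last by lia.
  rewrite mulnC modnMDl; move: (u %% 11) (ltn_pmod u (isT : 0 < 11)) => r.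
  move: kE; rewrite !inE => /or4P[|||/orP[]] /eqP ->.
  1-5: by case: r => [|[|[|[|[|[|[|[|[|[|[|r]]]]]]]]]]].
have := regular_nonresidue nonres.
rewrite /regular_series natrF2 modn2 mod0n; by case: odd.
Qed.
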